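(* For every fixed $\varepsilon>0$ and every fixed prime $p$, the following holds for all positive integers $n$. For any subset $A\subseteq \mathbb{F}_p^n$ not containing distinct vectors $x_1,\dots,x_p\in A$ with $x_1+\dots+x_p=0$, we have $|A|\le D_{\varepsilon,p}\cdot (C_\varepsilon p^{\varepsilon})^n$. Here, $C_\varepsilon$ is a constant only depending on $\varepsilon$, and $D_{\varepsilon,p}$ is a constant only depending on $\varepsilon$ and $p$. *)

(* Defs.v *)
From HB Require Import structures.
From mathcomp Require Import all_boot all_order all_algebra.
From mathcomp Require Import reals exp.

Set Implicit Arguments.
Unset Strict Implicit.
Unset Printing Implicit Defensive.

Import Order.TTheory GRing.Theory Num.Theory.
Local Open Scope ring_scope.

(* Distinctness of the p vectors is injectivity of the indexing family. *)
Definition has_distinct_zero_sum (p n : nat) (A : {set 'rV['F_p]_n}) : Prop :=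
  exists x : 'I_p -> 'rV['F_p]_n,
    [/\ injective x, forall i, x i \in A & \sum_(i < p) x i = 0].

(* Main.v *)
Require Import Defs.
From HB Require Import structures.
From mathcomp Require Import all_boot all_order all_algebra.
From mathcomp Require Import finfield zify.
From mathcomp Require Import boolp reals exp.

Set Implicit Arguments.
Unset Strict Implicit.
Unset Printing Implicit Defensive.

Import Order.TTheory GRing.Theory Num.Theory.
Local Open Scope ring_scope.

(* Fix G depending only on eps. Call an element u robust (for sizes k = G, G + 1)
   if, after the removal of any fewer than p elements of A, it is still a sum of k
   distinct elements of A. It is enough to find a zero-sum sequence of length p
   that splits into blocks of G or G + 1 distinct terms with robust block sums.

   Polynomial method. In a set X of more than 2^(n+nG+1) vectors some x satisfies
   r x = z_1 + ... + z_r with 0 < r <= s = p %/ G and all z_i in X \ {x}: otherwise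
   the indicator of sum_j (z_j - x) = 0, a polynomial of degree n(p-1) in the s + 1
   vectors x, z_1, ..., z_s, would be diagonal on X. If X is larger by a factor
   2p + 1, the z_i can moreover be made to avoid any p prescribed vectors, so that
   p x = 0 can be rewritten as a zero sum of length p in X in which no term occurs
   more than s times; such a sequence splits into blocks of distinct terms.

   Additive combinatorics. If the first of k + 1 elements of A can be guessed from
   their sum with non-negligible probability, then k-fold sums over a dense set of
   k-tuples take fewer values than (k+1)-fold sums by a factor of almost |A|; by
   Balog-Szemeredi-Gowers and Pluennecke a dense subset of A then has much smaller
   iterated sumsets. As |A| >= p^(eps n), this can happen only boundedly often, so
   some dense A' in A is unpredictable: nearly all of its G- and (G+1)-element
   subsets have robust sums. A random X in A' of size C^n then has only robust
   blocks. *)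

(** * Functions of low degree *)

Section PolyFun.
Variables (F : comNzRingType) (k n : nat).
Notation V := 'rV[F]_n.

(** [D] bounds the total degree in the coordinates of all [k] vectors jointly. The inductive form
    reduces linear statements to monomials. *)
Inductive poly_fun (D : nat) : (('I_k -> V) -> F) -> Prop :=
| PolyMono (c : F) (e : 'I_k -> 'I_n -> nat)
    (f : ('I_k -> V) -> F) :
    (\sum_j \sum_i e j i <= D)%N ->
    (forall y, f y = c * \prod_j \prod_i y j 0 i ^+ e j i) -> poly_fun D f
| PolyAdd f g h :
    poly_fun D f -> poly_fun D g -> (forall y, h y = f y + g y) -> poly_fun D h.

Lemma poly_fun_cst c D : poly_fun D (fun=> c).
Proof.
apply: (@PolyMono _ c (fun _ _ => 0%N)) => [|y].
  by rewrite big1 // => j _; rewrite big1.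
by rewrite big1 ?mulr1 // => j _; rewrite big1.
Qed.

Lemma poly_fun_ext D f g : (forall y, f y = g y) -> poly_fun D f -> poly_fun D g.
Proof.
move=> fg Pf; apply: (PolyAdd Pf (poly_fun_cst 0 D)) => y.
by rewrite addr0 fg.
Qed.

Lemma poly_funM D1 D2 f g :
  poly_fun D1 f -> poly_fun D2 g -> poly_fun (D1 + D2) (fun y => f y * g y).
Proof.
move=> Pf Pg; elim: Pf => {f} [c e f le_e Ef | f1 f2 f _ IH1 _ IH2 Ef].
- elim: Pg => {g} [c' e' g le_e' Eg | g1 g2 g _ IH1 _ IH2 Eg].
    have E : forall y, f y * g y = (c * c') * \prod_j \prod_i y j 0 i ^+ (e j i + e' j i)%N.
      move=> y; rewrite Ef Eg mulrACA -big_split; congr (_ * _); apply: eq_bigr => j _.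
      by rewrite -big_split; apply: eq_bigr => i _; rewrite exprD.
    apply: PolyMono E.
    under eq_bigr => j _ do rewrite big_split.
    by rewrite big_split leq_add.
  by apply: (PolyAdd IH1 IH2) => y; rewrite Eg mulrDr.
- by apply: (PolyAdd IH1 IH2) => y; rewrite Ef mulrDl.
Qed.

Lemma poly_fun_coord j i : poly_fun 1 (fun y : 'I_k -> V => y j 0 i).
Proof.
have E (y : 'I_k -> V) :
    y j 0 i = 1 * \prod_j' \prod_i' y j' 0 i' ^+ ((j' == j) && (i' == i) : nat).
  rewrite (bigD1 j) //= (bigD1 i) //= !eqxx expr1 big1 => [|i' /negPf->//].
  by rewrite big1 ?mul1r ?mulr1 // => j' /negPf nj; rewrite big1 // => i' _; rewrite nj.
apply: (PolyMono _ E).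
rewrite (bigD1 j) //= (bigD1 i) //= !eqxx big1 => [|i' /negPf->//].
by rewrite big1 // => j' /negPf nj; rewrite big1 // => i' _; rewrite nj.
Qed.

Lemma poly_fun_sum (I : Type) (r : seq I) D (f : I -> ('I_k -> V) -> F) :
  (forall a, poly_fun D (f a)) -> poly_fun D (fun y => \sum_(a <- r) f a y).
Proof.
move=> Pf; elim: r => [|a r IH].
  by apply: poly_fun_ext (poly_fun_cst 0 D) => y; rewrite big_nil.
by apply: (PolyAdd (Pf a) IH) => y; rewrite big_cons.
Qed.

Lemma poly_fun_prod (I : Type) (r : seq I) D (f : I -> ('I_k -> V) -> F) :
  (forall a, poly_fun D (f a)) ->
  poly_fun (size r * D) (fun y => \prod_(a <- r) f a y).
Proof.
move=> Pf; elim: r => [|a r IH].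
  by apply: poly_fun_ext (poly_fun_cst 1 _) => y; rewrite big_nil.
by apply: poly_fun_ext (poly_funM (Pf a) IH) => y; rewrite big_cons.
Qed.

Lemma poly_funX D f m : poly_fun D f -> poly_fun (m * D) (fun y => f y ^+ m).
Proof.
move=> Pf; have := poly_fun_prod (nseq m tt) (fun=> Pf).
by rewrite size_nseq; apply: poly_fun_ext => y; rewrite big_nseq iter_mulr_1.
Qed.

End PolyFun.


(** * Weights orthogonal to monomials of low degree *)

Section Kill.
Variables (F : finComNzRingType) (n d : nat).
Notation V := 'rV[F]_n.

Definition kills (h : V -> F) := forall e : 'I_n -> nat,
  (\sum_i e i <= d)%N -> \sum_x h x * \prod_i x 0 i ^+ e i = 0.

(** By pigeonhole, a monomial of degree less than [k * d.+1] has degree at most [d] in some vector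
    [y j]; the sum over that vector factors out and vanishes. *)
Lemma poly_fun_kills k D (f : ('I_k -> V) -> F) (h : 'I_k -> V -> F) :
  (D < k * d.+1)%N -> (forall j, kills (h j)) -> poly_fun D f ->
  \sum_(y : {ffun 'I_k -> V}) f y * \prod_j h j (y j) = 0.
Proof.
move=> ltD kh; elim=> {f} [c e f le_e Ef | f g fg _ IHf _ IHg E].
  have [j lej]: exists j, (\sum_i e j i <= d)%N.
    apply/existsP; apply: contraLR ltD => /existsPn nle; rewrite -leqNgt.
    apply: leq_trans le_e; rewrite -[k in (k * _)%N]card_ord -sum_nat_const.
    by apply: leq_sum => j _; rewrite ltnNge nle.
  transitivity (c * \sum_(y : {ffun 'I_k -> V})
      \prod_j (h j (y j) * \prod_i y j 0 i ^+ e j i)).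
    rewrite big_distrr; apply: eq_bigr => y _.
    by rewrite Ef -mulrA big_split /= [X in _ * X]mulrC.
  rewrite -(bigA_distr_bigA (fun j x => h j x * \prod_i x 0 i ^+ e j i)).
  by rewrite (bigD1 j) //= kh // mul0r mulr0.
rewrite (eq_bigr (fun y : {ffun _} =>
   f y * \prod_j h j (y j) + g y * \prod_j h j (y j))) => [|y _].
  by rewrite big_split /= IHf IHg addr0.
by rewrite E mulrDl.
Qed.

End Kill.

(** * Short additive relations in large subsets of a vector space *)

Definition low_exp n d := [set e : {ffun 'I_n -> 'I_d.+1} | (\sum_i e i <= d)%N].

(** Give [e] the weight [\prod_i 2 ^ (d - e i)]. Each low exponent weighs at least
    [2 ^ (n * d - d)], while the total weight factors over the coordinates and is at most
    [(2 ^ d.+1) ^ n]. *)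
Lemma card_low_exp n d : (#|low_exp n d| <= 2 ^ (n + d))%N.
Proof.
(* The case [n = 0] is separate because [n * d - d] truncates there. *)
have [->|n0] := posnP n.
  apply: leq_trans (max_card _) _; rewrite card_ffun !card_ord.
  by rewrite expn0 expn_gt0.
have le1 : (#|low_exp n d| * 2 ^ (n * d - d) <=
    \sum_(e : {ffun 'I_n -> 'I_d.+1}) \prod_i 2 ^ (d - e i))%N.
  rewrite -sum_nat_const big_mkcond /=; apply: leq_sum => e _.
  case: ifP => //; rewrite inE => le_d.
  rewrite -expn_sum leq_pexp2l //; apply: leq_trans (leq_sub2l _ le_d) _.
  rewrite leq_subLR -big_split /= -[X in (X * _)%N](card_ord n) -sum_nat_const.
  by apply: leq_sum => i _; rewrite -leq_subLR.
have le2 : (\sum_(a < d.+1) 2 ^ (d - a) <= 2 ^ d.+1)%N.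
  rewrite (reindex_inj rev_ord_inj) /=.
  rewrite (eq_bigr (fun a : 'I_d.+1 => 2 ^ a)%N) => [|a _].
    by have := predn_exp 2 d.+1; rewrite mul1n => <-; rewrite leq_pred.
  by rewrite subSS subKn // -ltnS.
rewrite -(bigA_distr_bigA (fun _ (a : 'I_d.+1) => 2 ^ (d - a))%N) in le1.
rewrite prod_nat_const card_ord in le1.
have le3 : ((\sum_(a < d.+1) 2 ^ (d - a)) ^ n <= (2 ^ d.+1) ^ n)%N by rewrite leq_exp2r.
rewrite -(leq_pmul2r (expn_gt0 2 (n * d - d))) (leq_trans (leq_trans le1 le3)) //.
rewrite -expnM -expnD leq_pexp2l //.
by rewrite mulSn mulnC -addnA subnKC // leq_pmull.
Qed.

Section Dependence.
Variables (F : finFieldType) (n d : nat).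
Notation V := 'rV[F]_n.

(** The matrix of low-degree monomials evaluated on [B] has more rows than columns, hence a nonzero
    vector in its left kernel; [h] is that vector extended by zero. *)
Lemma exists_kills (B : {set V}) : (#|low_exp n d| < #|B|)%N ->
  exists h : V -> F,
    [/\ kills d h, exists x, h x != 0 & forall v, v \notin B -> h v = 0].
Proof.
move=> ltB.
pose M : 'M[F]_(#|B|, #|low_exp n d|) := \matrix_(a, b)
  \prod_i (enum_val a : V) 0 i ^+ (enum_val b : {ffun 'I_n -> 'I_d.+1}) i.
have /rowV0Pn[v /sub_kermxP vM v0] : kermx M != 0.
  by rewrite -mxrank_eq0 mxrank_ker -lt0n subn_gt0 (leq_ltn_trans (rank_leq_col M)).
pose h (x : V) := \sum_(a | enum_val a == x) v 0 a.
have sumh (g : V -> F) : \sum_x h x * g x = \sum_a v 0 a * g (enum_val a).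
  under eq_bigr => x _ do rewrite big_distrl.
  rewrite (exchange_big_dep predT) //=; apply: eq_bigr => a _.
  by rewrite (big_pred1 (enum_val a)) // => x; rewrite eq_sym.
exists h; split=> [e le_e | | x xB].
- rewrite sumh; pose e' := [ffun i => inord (e i)] : {ffun 'I_n -> 'I_d.+1}.
  have e'E i : e' i = e i :> nat.
    rewrite ffunE inordK // ltnS; apply: leq_trans le_e.
    by rewrite (bigD1 i) //= leq_addr.
  have e'L : e' \in low_exp n d by rewrite inE; under eq_bigr => i _ do rewrite e'E.
  have /(congr1 (fun A : 'rV_ _ => A 0 (enum_rank_in e'L e'))) := vM.
  rewrite !mxE => E; rewrite -[RHS]E; apply: eq_bigr => a _; rewrite mxE.
  by rewrite enum_rankK_in //; congr (_ * _); apply: eq_bigr => i _; rewrite e'E.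
- have /matrix0Pn[i [a]] := v0; rewrite ord1 => va; exists (enum_val a).
  by rewrite /h (big_pred1 a) // => b; rewrite (inj_eq enum_val_inj).
- rewrite /h big_pred0 // => a; apply/negP => /eqP ax.
  by rewrite -ax enum_valP in xB.
Qed.

(** [B] is a maximal subset of [Y] at whose points the evaluations of low-degree monomials are
    independent. Adding [x] creates a dependency, nonzero at [x] since otherwise it would live on
    [B] alone. *)
Lemma exists_spanning (Y : {set V}) :
  exists B : {set V}, [/\ B \subset Y, (#|B| <= #|low_exp n d|)%N &
    forall x, x \in Y :\: B -> exists h : V -> F,
      [/\ kills d h, h x != 0 & forall v, v \notin x |: B -> h v = 0]].
Proof.
pose indep (B : {set V}) := forall h : V -> F, kills d h ->
  (forall v, v \notin B -> h v = 0) -> forall x, h x = 0.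
pose P (B : {set V}) := (B \subset Y) && `[< indep B >].
have P0 : P set0.
  by rewrite /P sub0set; apply/asboolP => h _ h0 x; rewrite h0 ?inE.
have [B /maxsetP[/andP[BY /asboolP indB] maxB] _] := maxset_exists P0.
exists B; split=> // [|x].
  rewrite leqNgt; apply/negP => /exists_kills[h [kh [x hx] h0]].
  by rewrite (indB _ kh h0) eqxx in hx.
rewrite inE => /andP[xB xY].
have : ~ indep (x |: B).
  move=> ind; suff E : x |: B = B by rewrite -E setU11 in xB.
  apply: maxB (subsetUr _ _); rewrite /P subUset sub1set xY BY.
  exact/asboolP.
move=> /existsNP[h] /not_implyP[kh] /not_implyP[h0] /existsNP[z hz].
exists h; split=> //; apply/eqP => hx; apply: hz; apply: indB => // v vB.
by have [->//|vx] := eqVneq v x; apply: h0; rewrite !inE negb_or vx.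
Qed.

End Dependence.

Lemma sum_subr (V : zmodType) (z : seq V) x :
  \sum_(v <- z) (v - x) = \sum_(v <- z) v - x *+ size z.
Proof.
elim: z => [|v z IH]; first by rewrite !big_nil subr0.
by rewrite !big_cons IH /= mulrS opprD addrACA.
Qed.

(* The low-degree monomials at x0 depend linearly on those at B0, and also on those at
   the disjoint set B1. The two dependencies h0 and h1 annihilate low degrees while
   their product is supported at x0, so weighting the diagonal indicator with them
   yields both 0 and its nonzero entry at x0. *)
Lemma exists_relation (F : finFieldType) n s d (X : {set 'rV[F]_n}) :
  (0 < s)%N -> (n * #|F|.-1 < s.+1 * d.+1)%N ->
  (2 * 2 ^ (n + d) < #|X|)%N ->
  exists2 x, x \in X & exists z : seq 'rV[F]_n,
    [/\ (0 < size z <= s)%N, {subset z <= X :\ x} & \sum_(v <- z) v = x *+ size z].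
Proof.
set q := #|F| => s0 ltD ltX; have q1 : (1 < q)%N := finRing_gt1 F.
apply: contrapT => norel.
have [B0 [B0X leB0 spB0]] := exists_spanning d X.
have [B1 [B1X leB1 spB1]] := exists_spanning d (X :\: B0).
have [x0 x0X] : exists x0, x0 \in X :\: B0 :\: B1.
  apply/set0Pn; rewrite -card_gt0 !cardsD subn_gt0.
  apply: leq_ltn_trans (subset_leq_card (subsetIr _ _)) _.
  rewrite ltn_subRL; apply: leq_ltn_trans ltX.
  rewrite mul2n -addnn leq_add // (leq_trans _ (card_low_exp n d)) //.
  exact: leq_trans (subset_leq_card (subsetIr _ _)) leB0.
have [h0 [kh0 h0x h0s]] := spB0 x0 ltac:(by move: x0X; rewrite !inE; case/and3P=> _ -> ->).
have [h1 [kh1 h1x h1s]] := spB1 x0 x0X.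
have h01 x : x != x0 -> h0 x * h1 x = 0.
  move=> xx0; have [xB1|xB1] := boolP (x \in B1).
    rewrite h0s ?mul0r // !inE negb_or xx0 /=.
    by have := subsetP B1X x xB1; rewrite inE => /andP[].
  by rewrite mulrC h1s ?mul0r // !inE negb_or xx0.
have h0X x : x \notin X -> h0 x = 0.
  move=> xX; apply: h0s; apply: contra xX; rewrite !inE => /orP[/eqP->|/(subsetP B0X)//].
  by move: x0X; rewrite !inE => /and3P[].
have h1X x : x \notin X -> h1 x = 0.
  move=> xX; apply: h1s; apply: contra xX.
  rewrite !inE => /orP[/eqP->|/(subsetP B1X)]; last by rewrite inE => /andP[].
  by move: x0X; rewrite !inE => /and3P[].
(* As [0 < s], both weights occur: a constant tuple at [x] gets a multiple of [h0 x * h1 x], which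
   vanishes unless [x = x0]. *)
pose h (j : 'I_s.+1) := if j == ord0 then h0 else h1.
have kh j : kills d (h j) by rewrite /h; case: ifP.
have hX j x : x \notin X -> h j x = 0 by rewrite /h; case: ifP => _; [apply: h0X | apply: h1X].
pose D (y : 'I_s.+1 -> 'rV[F]_n) := \sum_(j < s) (y (lift ord0 j) - y ord0).
(* Nonzero elements of [F] have [q.-1]-th power 1, so [T] is the indicator of [D y = 0] as a
   polynomial of degree at most [n * q.-1]. *)
pose T y := \prod_(i <- enum 'I_n) (1 - D y 0 i ^+ q.-1).
have TE y : T y = (D y == 0)%:R.
  rewrite /T; have [->|/matrix0Pn[i0 [i]]] := eqVneq.
    rewrite big1 // => i _; rewrite mxE expr0n gtn_eqF ?subr0 //.
    by rewrite -ltnS prednK // ltnW.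
  rewrite ord1 => Di; rewrite (bigD1_seq i) ?enum_uniq ?mem_enum //=.
  suff -> : D y 0 i ^+ q.-1 = 1 by rewrite subrr mul0r.
  apply: (mulfI Di); rewrite -exprS prednK ?(ltnW q1) // mulr1.
  exact: expf_card.
have PT : poly_fun (n * q.-1) T.
  suff PTi i : poly_fun q.-1 (fun y : 'I_s.+1 -> _ => 1 - D y 0 i ^+ q.-1).
    by have := poly_fun_prod (enum 'I_n) PTi; rewrite size_enum_ord.
  have PD : poly_fun 1 (fun y : 'I_s.+1 -> _ => D y 0 i).
    apply: (poly_fun_ext (f := fun y : 'I_s.+1 -> 'rV_n =>
       \sum_(j < s) (y (lift ord0 j) 0 i + -1 * y ord0 0 i))).
      by move=> y; rewrite /D summxE; apply: eq_bigr => j _; rewrite !mxE mulN1r.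
    apply: poly_fun_sum => j.
    have PN := poly_funM (D1 := 0) (poly_fun_cst s.+1 n (-1) 0) (poly_fun_coord F ord0 i).
    exact: PolyAdd (poly_fun_coord F (lift ord0 j) i) PN (fun=> erefl _).
  have := poly_funX q.-1 PD; rewrite muln1 => PX.
  apply: (PolyAdd (poly_fun_cst s.+1 n 1 _) (poly_funM (D1 := 0) (poly_fun_cst s.+1 n (-1) 0) PX)).
  by move=> y; rewrite mulN1r.
have := poly_fun_kills ltD kh PT.
pose y0 : {ffun 'I_s.+1 -> 'rV[F]_n} := [ffun=> x0].
(* Every [y] other than [y0] contributes zero: it leaves [X], or is constant away from [x0], or has
   [D y != 0]; a nonconstant [y] with [D y = 0] would give a relation after dropping the terms equal
   to [y ord0]. *)
rewrite (bigD1 y0) //= [X in _ + X]big1 ?addr0 => [|y yy0].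
  rewrite TE (_ : D y0 = 0); last by rewrite /D big1 // => j _; rewrite !ffunE subrr.
  rewrite eqxx mul1r => /eqP; apply/negP; apply/prodf_neq0 => j _.
  by rewrite ffunE /h; case: ifP.
have [/existsP[j yj]|] := boolP [exists j, y j \notin X].
  by rewrite (bigD1 j) //= hX // mul0r mulr0.
rewrite negb_exists => /forallP yX.
have [/forallP yc|] := boolP [forall j, y j == y ord0].
  have yx0 : y ord0 != x0.
    apply: contra yy0 => /eqP y00; apply/eqP/ffunP => j.
    by rewrite ffunE -y00; apply/eqP.
  rewrite (bigD1 ord0) //= (bigD1 (lift ord0 (Ordinal s0))) //= /h !eqxx /=.
  by rewrite (eqP (yc (lift _ _))) mulrA [X in _ * (X * _)]h01 // mul0r mulr0.
rewrite negb_forall => /existsP[j yj].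
rewrite TE; case: eqP => [Dy|]; last by rewrite mul0r.
case: norel; exists (y ord0); first by have := yX ord0; rewrite negbK.
exists [seq y (lift ord0 j) | j <- enum 'I_s & y (lift ord0 j) != y ord0]; split.
- rewrite size_map size_filter.
  rewrite (leq_trans (count_size _ _)) ?size_enum_ord // andbT -has_count.
  case: (unliftP ord0 j) yj => [j' ->|->]; last by rewrite eqxx.
  by move=> yj; apply/hasP; exists j' => //; rewrite mem_enum.
- move=> v /mapP[j']; rewrite mem_filter => /andP[yj' _ ->].
  by rewrite !inE yj'; have := yX (lift ord0 j'); rewrite negbK.
- apply/eqP; rewrite -subr_eq0 -sum_subr big_map big_filter big_mkcond /=.
  rewrite -[X in X == 0](_ : D y = _) ?Dy //.
  transitivity (\sum_(j <- enum 'I_s) (y (lift ord0 j) - y ord0)); first by rewrite big_enum.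
  by apply: eq_bigr => j' _; case: eqP => //= ->; rewrite subrr.
Qed.

(** * Balanced zero-sum sequences *)

Lemma card_filter_set (T : finType) (X : {set T}) (P : pred T) :
  #|[set y in X | P y]| = (\sum_(y in X) P y)%N.
Proof.
rewrite -sum1_card big_mkcond [RHS]big_mkcond /=.
by apply: eq_bigr => y _; rewrite inE; case: (y \in X); case: (P y).
Qed.

(** Out-degrees at most [k] force some vertex to have in-degree at most [k]. Greedily keep it and
    delete its at most [2 * k] neighbours. *)
Lemma digraph_indep (T : finType) (e : rel T) k (X : {set T}) :
  (forall x, x \in X -> (#|[set y in X | e x y]| <= k)%N) ->
  exists I : {set T}, [/\ I \subset X, (#|X| <= (2 * k + 1) * #|I|)%N &
    {in I &, forall x y, x != y -> ~~ e x y}].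
Proof.
have [m] := ubnP #|X|; elim: m => // m IHm in X * => ltX degX.
have [->|/set0Pn[x1 x1X]] := eqVneq X set0.
  by exists set0; split; rewrite ?sub0set ?cards0 // => x; rewrite inE.
have [x xX degx] : exists2 x, x \in X & (#|[set y in X | e y x]| <= k)%N.
  apply/exists_inP; apply: contraT => /exists_inPn deg.
  have: (\sum_(x in X) #|[set y in X | e y x]| <= \sum_(x in X) k)%N.
    rewrite (eq_bigr _ (fun x _ => card_filter_set X (e^~ x))) exchange_big /=.
    by apply: leq_sum => y /degX; rewrite card_filter_set.
  have : (#|X| * k.+1 <= \sum_(x in X) #|[set y in X | e y x]|)%N.
    by rewrite -sum_nat_const; apply: leq_sum => y yX; rewrite ltnNge deg.
  move=> le1 le2; have := leq_trans le1 le2; rewrite sum_nat_const.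
  by rewrite leq_pmul2l ?ltnn // card_gt0; apply/set0Pn; exists x1.
pose N := [set y in X | e x y] :|: [set y in X | e y x].
have [|y|I [IX leX indI]] := IHm (X :\: (x |: N)).
- rewrite ltnS in ltX; apply: leq_trans ltX; apply/proper_card/properP.
  split; first exact: subsetDl.
  by exists x => //; rewrite !inE eqxx.
- rewrite inE => /andP[_ /degX]; apply: leq_trans; apply: subset_leq_card.
  by apply/subsetP => z; rewrite !inE => /andP[/andP[_ ->]].
have xI : x \notin I by apply/negP => /(subsetP IX); rewrite !inE eqxx.
exists (x |: I); split.
- by rewrite subUset sub1set xX (subset_trans IX) ?subsetDl.
- rewrite cardsU1 xI /= mulnDr muln1.
  rewrite (leq_trans (_ : _ <= #|x |: N| + #|X :\: (x |: N)|)%N) //.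
    by rewrite -(cardsID (x |: N) X) leq_add2r subset_leq_card ?subsetIr.
  apply: leq_add => //; rewrite (leq_trans (leq_card_setU _ _)) // cards1 addnC leq_add2r.
  by rewrite (leq_trans (leq_card_setU _ _)) // mul2n -addnn leq_add ?degX.
- have step y : y \in I -> ~~ e x y /\ ~~ e y x.
    by move=> /(subsetP IX); rewrite !inE !negb_or => /andP[/and3P[_ exy eyx] yX];
       move: exy eyx; rewrite yX.
  move=> y z; rewrite !inE => /orP[/eqP->|yI] /orP[/eqP->|zI]; rewrite ?eqxx //.
  + by have [] := step z zI.
  + by have [] := step y yI.
  + exact: indI.
Qed.

(* Copies of x are traded for the right-hand sides of relations with pairwise
   disjoint supports; fewer than s+1 copies of x are left over. *)
Lemma balanced_of_relations (V : nmodType) (p s : nat) (x : V) (X : {pred V}) :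
  x \in X -> x *+ p = 0 ->
  (forall E : seq V, (size E <= p)%N -> x \notin E -> exists z : seq V,
    [/\ (0 < size z <= s)%N, {subset z <= X}, x \notin z, ~~ has (mem E) z &
        \sum_(v <- z) v = x *+ size z]) ->
  exists w : seq V, [/\ size w = p, {subset w <= X}, forall v, (count_mem v w <= s)%N &
    \sum_(v <- w) v = 0].
Proof.
move=> xX px0 ext.
have [w [le_wp wX xw cw [sw lew]]] : exists w : seq V, [/\ (size w <= p)%N,
    {subset w <= X}, x \notin w, forall v, (count_mem v w <= s)%N &
    \sum_(v <- w) v = x *+ size w /\ (p - size w <= s)%N].
  suff build m : exists w : seq V, [/\ (size w <= p)%N,
    {subset w <= X}, x \notin w, forall v, (count_mem v w <= s)%N &
    \sum_(v <- w) v = x *+ size w /\ ((p - size w <= s)%N \/ (m <= size w)%N)].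
    have [w [lew wX xw cw [sw [lps|]]]] := build p; exists w; split=> //; split=> //.
    lia.
  elim: m => [|m [w [lew wX xw cw [sw [lps|lem]]]]].
  - by exists [::]; split=> //; rewrite big_nil; split=> //; right.
  - by exists w; split=> //; split=> //; left.
  - have [lps|gts] := leqP (p - size w) s; first by exists w; split=> //; split=> //; left.
    have [z [/andP[z0 zs] zX xz wz sz]] := ext w lew xw.
    exists (w ++ z); split.
    + rewrite size_cat; lia.
    + by move=> v; rewrite mem_cat => /orP[/wX|/zX].
    + by rewrite mem_cat negb_or xw.
    + move=> v; rewrite count_cat; have [vw|vw] := boolP (v \in w).
        rewrite (count_memPn (_ : v \notin z)) ?addn0 //.
        by apply: contra wz => vz; apply/hasP; exists v.
      by rewrite (count_memPn vw) (leq_trans (count_size _ _)).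
    + rewrite big_cat sw sz size_cat mulrnDr; split=> //; right; lia.
exists (w ++ nseq (p - size w) x); split.
- by rewrite size_cat size_nseq subnKC.
- by move=> v; rewrite mem_cat => /orP[/wX//|]; rewrite mem_nseq => /andP[_ /eqP->].
- move=> v; rewrite count_cat count_nseq /=; have [<-|_] := eqVneq x v.
    by rewrite (count_memPn xw) mul1n.
  by rewrite addn0.
- by rewrite big_cat sw big_nseq iter_addr_0 /= -mulrnDr subnKC.
Qed.

(** Without a balanced sequence, [balanced_of_relations] yields for each [x] in [X] a set [E x] of
    at most [p] vectors meeting all short relations at [x]. On a subset independent for the digraph
    [y \in E x], [exists_relation] finds a relation avoiding [E x]. Passing to that subset costs the
    factor [2 * p + 1]. *)
Lemma exists_balanced_zero_sum p n s d (X : {set 'rV['F_p]_n}) :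
  prime p -> (0 < s)%N -> (n * p.-1 < s.+1 * d.+1)%N ->
  ((2 * p + 1) * (2 * 2 ^ (n + d)) < #|X|)%N ->
  exists w : seq 'rV['F_p]_n, [/\ size w = p, {subset w <= X},
    forall v, (count_mem v w <= s)%N & \sum_(v <- w) v = 0].
Proof.
move=> p_pr s0 ltD ltX; apply: contrapT => nobal.
have px0 (x : 'rV['F_p]_n) : x *+ p = 0.
  by rewrite -scaler_nat pchar_Fp_0 // scale0r.
have /choice[E Eprop] (x : 'rV['F_p]_n) : exists E : seq 'rV['F_p]_n, x \in X ->
    [/\ (size E <= p)%N, x \notin E & forall z : seq 'rV['F_p]_n,
     (0 < size z <= s)%N -> {subset z <= X} -> x \notin z ->
        \sum_(v <- z) v = x *+ size z -> has (mem E) z].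
  apply: contrapT => noE; apply: nobal.
  have xX : x \in X by apply: contrapT => xX; case: noE; exists [::].
  apply: (balanced_of_relations xX (px0 x)) => E leE xE.
  apply: contrapT => noz; case: noE; exists E => _; split=> // z z0 zX xz sz.
  by apply: contrapT => /negP hz; apply: noz; exists z.
have [|I [IX leX indI]] := @digraph_indep _ (fun x y => y \in E x) p X.
  move=> x /Eprop[leE _ _]; rewrite (leq_trans _ leE) // (leq_trans _ (card_size _)) //.
  by apply: subset_leq_card; apply/subsetP => y; rewrite inE => /andP[].
have := @exists_relation 'F_p n s d I s0.
rewrite card_Fp // => /(_ ltD)[|x xI [z [z0 zI sz]]].
  rewrite -(@ltn_pmul2l (2 * p + 1)); last by rewrite addn1.
  exact: leq_trans ltX leX.
have [_ _ /(_ z z0)] := Eprop x (subsetP IX x xI).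
have zX : {subset z <= X} by move=> v /zI; rewrite inE => /andP[_ /(subsetP IX)].
have xz : x \notin z by apply/negP => /zI; rewrite !inE eqxx.
case/(_ zX xz sz)/hasP=> v vz vE.
have /setD1P[vx vI] := zI v vz.
by have := indI x v xI vI; rewrite eq_sym vx => /(_ isT)/negP[].
Qed.

(* Sorting makes equal terms contiguous; putting position a in class a mod s
   then separates them, because no term occurs more than s times. *)
Lemma distinct_classes (T : finType) (w : seq T) (s : nat) :
  (forall v, (count_mem v w <= s)%N) ->
  exists2 w', perm_eq w' w & forall x0 a b, (a < b < size w)%N ->
    a = b %[mod s] -> nth x0 w' a != nth x0 w' b.
Proof.
move=> cw; pose le (x y : T) := (enum_rank x <= enum_rank y)%N.
have le_tr : transitive le by move=> y x z; apply: leq_trans.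
have le_tot : total le by move=> x y; apply: leq_total.
exists (sort le w) => [|x0 a b /andP[ab bw] eqab]; first by rewrite perm_sort.
apply/eqP => eqn; set w' := sort le w in eqn.
have sw' : size w' = size w by rewrite size_sort.
have srt : sorted le w' by apply: sort_sorted.
have mid c : (a <= c <= b)%N -> nth x0 w' c = nth x0 w' a.
  move=> /andP[ac cb].
  have leN := sorted_leq_nth le_tr (fun x => leqnn _) x0 srt.
  apply/enum_rank_inj/val_inj/anti_leq/andP; split.
    by rewrite eqn; apply: leN => //; rewrite inE sw' ?(leq_ltn_trans cb).
  by apply: leN => //; rewrite inE sw' ?(leq_ltn_trans cb) // (ltn_trans ab).
have sab : (s <= b - a)%N.
  apply: dvdn_leq; first by rewrite subn_gt0.
  by rewrite -eqn_mod_dvd ?(ltnW ab) // eqab.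
move: mid; set v := nth x0 w' a => mid.
have := cw v; rewrite leqNgt => /negP[].
rewrite -(permP (permEl (perm_sort le w))) -/w'.
rewrite -(cat_take_drop a w') count_cat (leq_trans _ (leq_addl _ _)) //.
rewrite -(cat_take_drop (b - a).+1 (drop a w')) count_cat (leq_trans _ (leq_addr _ _)) //.
suff /all_pred1P-> : all (pred1 v) (take (b - a).+1 (drop a w')).
  rewrite count_nseq /= eqxx mul1n size_takel ?ltnS // size_drop sw'.
  by rewrite ltn_sub2r // (ltn_trans ab).
apply/(all_nthP x0) => i; rewrite size_takel ?size_drop ?sw'; last first.
  by rewrite ltn_sub2r // (ltn_trans ab).
rewrite ltnS => ib /=; rewrite nth_take // nth_drop mid // leq_addr /=.
by rewrite -(subnKC (ltnW ab)) leq_add2l.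
Qed.

(** Positions are grouped by their residue [i] modulo [s]; the first [r] residues occur once more
    than the others. *)
Lemma sum_residue_classes (V : nmodType) (f : nat -> V) (s G r : nat) :
  (r <= s)%N ->
  \sum_(i < s) \sum_(t < G + (i < r)) f (i + s * t)%N = \sum_(a < s * G + r) f a.
Proof.
move=> rs; transitivity (\sum_(i < s) (\sum_(t < G) f (i + s * t)%N
     + (if (i < r)%N then f (i + s * G)%N else 0))).
  apply: eq_bigr => i _; case: ifP => _; last by rewrite addn0 addr0.
  by rewrite addn1 big_ord_recr.
rewrite big_split exchange_big big_split_ord /=; congr (_ + _).
  elim: G => [|G IH]; first by rewrite muln0 !big_ord0.
  rewrite big_ord_recr /= IH mulnSr big_split_ord /=; congr (_ + _).
  by apply: eq_bigr => i _; rewrite addnC.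
rewrite -big_mkcond (big_ord_narrow rs) /=.
by apply: eq_bigr => i _; rewrite addnC.
Qed.

(** * From robust sums to distinct zero sums *)

Definition robust (V : finZmodType) (A : {set V}) (p k : nat) (u : V) :=
  forall U : {set V}, (#|U| < p)%N -> exists R : {set V},
    [/\ R \subset A, #|R| = k, \sum_(x in R) x = u & [disjoint U & R]].

(** Greedy choice: every block is nonempty, so the blocks already placed occupy fewer than [p]
    elements and the next one can avoid them. *)
Lemma robust_combine (V : finZmodType) (A : {set V}) (p : nat) (I : Type)
    (r : seq I) (k : I -> nat) (u : I -> V) :
  (forall i, 0 < k i)%N -> (forall i, robust A p (k i) (u i)) ->
  (\sum_(i <- r) k i <= p)%N ->
  exists U : {set V}, [/\ U \subset A, #|U| = (\sum_(i <- r) k i)%N &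
    \sum_(x in U) x = \sum_(i <- r) u i].
Proof.
move=> k0 rob; elim: r => [|i r IH].
  by exists set0; split; rewrite ?sub0set ?cards0 ?big_nil // big_set0.
rewrite !big_cons => lep.
have [|U [UA cU sU]] := IH; first by rewrite (leq_trans _ lep) ?leq_addl.
have [|R [RA cR sR dUR]] := rob i U.
  by rewrite cU (leq_trans _ lep) // -add1n leq_add2r.
have dRU : [disjoint R & U] by rewrite disjoint_sym.
exists (R :|: U); split; first by rewrite subUset RA.
  by rewrite cardsU disjoint_setI0 // cards0 subn0 cR cU.
by rewrite -sR -sU -bigU //; apply: eq_bigl => x; rewrite inE.
Qed.

(** The residue classes of positions modulo [s] in a balanced zero-sum sequence are blocks of [G] or
    [G.+1] distinct terms. Robustness then replaces them by pairwise disjoint blocks with the same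
    sums. *)
Lemma zero_sum_of_robust p n G (A X : {set 'rV['F_p]_n}) :
  prime p -> (0 < G)%N -> (G ^ 2 <= p)%N ->
  ((2 * p + 1) * (2 * 2 ^ (n + n * G)) < #|X|)%N ->
  (forall B : {set 'rV['F_p]_n}, B \subset X -> (G <= #|B| <= G.+1)%N ->
     robust A p #|B| (\sum_(x in B) x)) ->
  has_distinct_zero_sum A.
Proof.
move=> p_pr G0 Gp ltX rob.
pose s := (p %/ G)%N; pose r := (p %% G)%N.
have pE : p = (s * G + r)%N by rewrite -divn_eq.
(* Here [G ^ 2 <= p] enters: it gives [r < G <= s], so the [r] leftover positions go to different
   classes. *)
have Gs : (G <= s)%N by rewrite leq_divRL // -expnSr.
have rs : (r <= s)%N by apply: leq_trans Gs; rewrite ltnW ?ltn_pmod.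
have s0 : (0 < s)%N by apply: leq_trans Gs.
(* Degree [n * G] suffices because [p < s.+1 * G]. *)
have ltD : (n * p.-1 < s.+1 * (n * G).+1)%N.
  apply: (@leq_ltn_trans (n * (s.+1 * G))).
    by rewrite leq_mul2l (leq_trans (leq_pred p)) ?orbT // ltnW // ltn_ceil.
  by rewrite mulnCA ltn_mul2l /=.
have [w [sw wX cw w0]] := exists_balanced_zero_sum p_pr s0 ltD ltX.
have [w' pw nw] := distinct_classes cw.
have sw' : size w' = p by rewrite (perm_size pw).
pose f a := nth 0 w' a.
pose k (i : 'I_s) := (G + (i < r))%N.
have ltp (i : 'I_s) (t : 'I_(k i)) : (i + s * t < p)%N.
  have lts := ltn_ord i; move: (nat_of_ord t) (ltn_ord t) => {}t.
  rewrite /k [in (_ < p)%N]pE.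
  case: (ltnP i r) => ir ltt.
    have tG : (t <= G)%N by move: ltt; rewrite addn1 ltnS.
    by rewrite addnC -addnS leq_add // leq_mul2l tG orbT.
  rewrite addn0 in ltt.
  have : (s * t.+1 <= s * G)%N by rewrite leq_mul2l ltt orbT.
  rewrite mulnS => ?; rewrite (leq_trans _ (leq_addr _ _)) //.
  by apply: leq_trans (_ : _ <= s + s * t)%N _; rewrite // -addSn leq_add2r.
pose B i := [set f (i + s * t)%N | t : 'I_(k i)].
have finj i : injective (fun t : 'I_(k i) => f (i + s * t)%N).
  suff lt_neq (t t' : 'I_(k i)) : (t < t')%N -> f (i + s * t)%N != f (i + s * t')%N.
    move=> t t' /eqP ftt; apply/val_inj; case: (ltngtP t t') => // /lt_neq.
      by rewrite ftt.
    by rewrite eq_sym ftt.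
  move=> ltt; apply: nw; last by rewrite ![(i + _)%N]addnC ![(s * _)%N]mulnC !modnMDl.
  by rewrite sw ltp ltn_add2l ltn_pmul2l ?ltt.
have cB i : #|B i| = k i by rewrite /B (card_imset _ (finj i)) card_ord.
have sB i : \sum_(x in B i) x = \sum_(t < k i) f (i + s * t)%N.
  by rewrite big_imset //= => t t' _ _; apply: finj.
have robB i : robust A p (k i) (\sum_(t < k i) f (i + s * t)%N).
  rewrite -(sB i) -(cB i); apply: rob.
    apply/subsetP => x /imsetP[t _ ->]; apply: wX.
    by rewrite -(perm_mem pw) mem_nth // sw'.
  by rewrite cB /k leq_addr -[G.+1]addn1 leq_add2l leq_b1.
have kp : (\sum_i k i = p)%N.
  have := @sum_residue_classes nat (fun=> 1%N) s G r rs.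
  rewrite -pE sum1_card card_ord => E; rewrite -[RHS]E; apply: eq_bigr => i _.
  by rewrite sum1_card card_ord.
have [||U [UA cU sU]] := @robust_combine _ A p _ (index_enum 'I_s) k _ _ robB.
- by move=> i; rewrite addn_gt0 G0.
- by rewrite kp.
rewrite sum_residue_classes // -pE in sU; rewrite kp in cU.
exists (fun i => enum_val (cast_ord (esym cU) i)); split.
- by move=> i j /enum_val_inj/cast_ord_inj.
- by move=> i; apply: (subsetP UA); apply: enum_valP.
- have bij : bijective (cast_ord (esym cU)).
    by exists (cast_ord cU); [apply: cast_ordKV | apply: cast_ordK].
  transitivity (\sum_(x in U) x).
    by rewrite [RHS]big_enum_val [RHS](reindex _ (onW_bij _ bij)).
  by rewrite sU -[RHS]w0 -(perm_big _ pw) /= (big_nth 0) sw' big_mkord.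
Qed.

(** * Unpredictable sets *)

Lemma union_bound (T I : finType) (F : I -> {set T}) (S : {set T}) :
  (forall x, x \in S -> exists i, x \in F i) -> (#|S| <= \sum_i #|F i|)%N.
Proof.
move=> SF; rewrite -sum1_card (eq_bigr (fun i => \sum_(x in F i) 1)%N) => [|i _]; last by rewrite sum1_card.
rewrite (exchange_big_dep predT) //= big_mkcond; apply: leq_sum => x _.
by case: ifP => // /SF[i xi]; rewrite (bigD1 i).
Qed.

Section Tuples.
Variable V : finZmodType.
Implicit Types (A : {set V}) (E : V -> {set V}).

Definition tuples_in A k := [set w : k.-tuple V | all [in A] w].

Lemma big_tuples_in A k (F : k.+1.-tuple V -> nat) :
  (\sum_(w in tuples_in A k.+1) F w =
   \sum_(a in A) \sum_(w in tuples_in A k) F [tuple of a :: w])%N.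
Proof.
rewrite pair_big /= (reindex (fun p : V * k.-tuple V => [tuple of p.1 :: p.2])) /=.
  by apply: eq_bigl => -[a w]; rewrite !inE.
exists (fun w : k.+1.-tuple V => (thead w, [tuple of behead w])) => [[a w] _|w _].
  by congr (_, _); apply/val_inj.
by apply/val_inj; rewrite /= [in RHS](tuple_eta w).
Qed.

Lemma card_tuples_in A k : #|tuples_in A k| = (#|A| ^ k)%N.
Proof.
elim: k => [|k IH].
  rewrite expn0; apply/eqP/cards1P; exists [tuple]; apply/setP => w.
  by rewrite !inE tuple0 /= eqxx.
by rewrite -sum1_card big_tuples_in /= sum_nat_const sum1_card IH expnS.
Qed.

(* The first of k+1 independent elements of A can be guessed from their sum,
   with M guesses, with probability at most 1/Q. *)
Definition unpredictable A k M Q := forall E, (forall u, #|E u| <= M)%N ->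
  (Q * (\sum_(a in A) \sum_(w in tuples_in A k) (a \in E (a + \sum_(x <- w) x)%R)) <=
   #|A| ^ k.+1)%N.

(** Fixing one more summand [z] merely translates the guessing sets, so an average over [z] cannot
    help the guesser. *)
Lemma unpredictableS A k M Q : unpredictable A k M Q -> unpredictable A k.+1 M Q.
Proof.
move=> unp E leE; under eq_bigr => a _ do rewrite big_tuples_in.
rewrite exchange_big big_distrr /= expnS -sum_nat_const; apply: leq_sum => z _.
apply: leq_trans (unp (fun u => E (z + u)%R) _) => [|u]; last exact: leE.
rewrite leq_mul2l leq_sum ?orbT // => a _; apply: leq_sum => w _.
by rewrite big_cons addrCA.
Qed.

Lemma unpredictable_leq A k l M Q :
  (k <= l)%N -> unpredictable A k M Q -> unpredictable A l M Q.
Proof.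
by move=> /subnK<-; elim: (l - k)%N => // m IH /IH; apply: unpredictableS.
Qed.

(** The values of a random [f] at distinct indices are independent and uniform. The injection [phi]
    records the values of [f] along [t] and overwrites them with the given tuple. *)
Lemma card_ffun_tuple_in A k N (S : {set k.-tuple V}) (t : k.-tuple 'I_N) :
  uniq t ->
  (#|[set f in ffun_on A | map_tuple f t \in S]| * #|A| ^ k <= #|S| * #|A| ^ N)%N.
Proof.
move=> ut; rewrite -card_tuples_in -[N in leqRHS]card_ord -card_ffun_on.
rewrite -(cardsE (ffun_on (mem A))) -!cardsX.
pose phi (p : {ffun 'I_N -> V} * k.-tuple V) := (map_tuple p.1 t,
  [ffun i => if i \in t then nth 0 p.2 (index i t) else p.1 i]).
rewrite -(card_in_imset (f := phi)) => [|[f y] [f' y'] _ _ /= [/eqP mapE /ffunP E]].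
  apply/subset_leq_card/subsetP => _ /imsetP[[f y] + ->].
  rewrite !inE /= => /andP[/andP[/ffun_onP fA fS] /allP yA]; rewrite fS /=.
  apply/ffun_onP => i; rewrite ffunE; case: ifP => // it; apply: yA.
  by rewrite mem_nth // size_tuple -[ltnRHS](size_tuple t) index_mem.
congr (_, _).
  apply/ffunP => i; have := E i; rewrite !ffunE; case: ifP => // it _.
  have /(congr1 (fun s => nth 0 s (index i t))) := eqP mapE.
  by rewrite !(nth_map i) ?index_mem // nth_index.
apply: eq_from_tnth => j; have := E (tnth t j); rewrite !ffunE mem_tnth.
by rewrite (tnth_nth (tnth t j)) index_uniq ?size_tuple // -!tnth_nth.
Qed.

Lemma card_predicted A k M Q N E (t : k.+1.-tuple 'I_N) :
  (0 < #|A|)%N -> unpredictable A k M Q -> (forall u, #|E u| <= M)%N -> uniq t ->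
  (Q * #|[set f : {ffun 'I_N -> V} in ffun_on A |
            f (thead t) \in E (\sum_(i <- t) f i)%R]| <= #|A| ^ N)%N.
Proof.
move=> A0 unp leE ut.
pose S := [set w in tuples_in A k.+1 | thead w \in E (\sum_(x <- w) x)%R].
have leS : (Q * #|S| <= #|A| ^ k.+1)%N.
  apply: leq_trans (unp E leE); rewrite leq_mul2l card_filter_set big_tuples_in.
  by rewrite leq_sum ?orbT // => a _; apply: leq_sum => w _; rewrite big_cons theadE.
rewrite -(leq_pmul2r (_ : 0 < #|A| ^ k.+1)%N) ?expn_gt0 ?A0 // -mulnA.
apply: leq_trans (_ : Q * (#|S| * #|A| ^ N) <= _)%N; last first.
  by rewrite mulnA [leqRHS]mulnC leq_mul2r leS orbT.
rewrite leq_mul2l; apply/orP; right; apply: leq_trans (card_ffun_tuple_in A S ut).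
rewrite leq_mul2r; apply/orP; right; apply/subset_leq_card/subsetP => f.
rewrite !inE => /andP[/ffun_onP fA ft]; apply/andP; split; first exact/ffun_onP.
apply/andP; split; first by apply/allP => _ /mapP[i _ ->].
by rewrite /thead tnth_map big_map.
Qed.

(** Union bound for a random [f] from ['I_N] to [A]. A sum that is not robust has a small set [E]
    meeting all its representations, so some term of a block with that sum is guessed from it. There
    are at most [3 * N ^ g.+2] bad events, each of probability at most [1 / Q]. *)
Lemma exists_robust_subset A p g Q N :
  (0 < N)%N -> (3 * N ^ g.+2 < Q)%N -> (Q <= #|A|)%N -> unpredictable A g p Q ->
  exists X : {set V}, [/\ X \subset A, #|X| = N &
    forall B : {set V}, B \subset X -> (g.+1 <= #|B| <= g.+2)%N ->
      robust A p #|B| (\sum_(x in B) x)].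
Proof.
move=> N0 ltQ QA unp; have A0 : (0 < #|A|)%N by lia.
have /choice[E Eprop] (ku : nat * V) : exists U : {set V}, (#|U| <= p)%N /\
    (~ robust A p ku.1 ku.2 -> forall R : {set V}, R \subset A -> #|R| = ku.1 ->
       \sum_(x in R) x = ku.2 -> ~~ [disjoint U & R]).
  have [rob|nrob] := pselect (robust A p ku.1 ku.2).
    by exists set0; rewrite cards0.
  move/existsNP: (nrob) => [U] /not_implyP[ltU noR]; exists U; split; first exact: ltnW.
  by move=> _ R RA cR sR; apply/negP => dUR; apply: noR; exists R.
pose bad k (t : k.-tuple 'I_N) := [set f : {ffun 'I_N -> V} in ffun_on A |
  uniq t && [exists i, (ohead t == Some i) && (f i \in E (k, \sum_(i <- t) f i)%R)]].
have bad_le k (t : k.+1.-tuple 'I_N) : unpredictable A k p Q -> (Q * #|bad _ t| <= #|A| ^ N)%N.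
  move=> unpk; have [ut|nut] := boolP (uniq t); last first.
    rewrite /bad (negbTE nut) (eqP (_ : #|_| == 0%N)) ?muln0 // cards_eq0.
    by apply/eqP/setP => f; rewrite !inE andbF.
  apply: leq_trans (card_predicted A0 unpk (fun u => (Eprop (k.+1, u)).1) ut).
  rewrite leq_mul2l; apply/orP; right; apply/subset_leq_card/subsetP => f.
  rewrite !inE ut /= => /andP[-> /existsP[i]] /=.
  by rewrite {1}(tuple_eta t) /= => /andP[/eqP[<-]].
(* Collisions have probability at most [1 / #|A|], hence at most [1 / Q]. *)
pose coll (i j : 'I_N) := [set f : {ffun 'I_N -> V} in ffun_on A | (i != j) && (f i == f j)].
have coll_le i j : (Q * #|coll i j| <= #|A| ^ N)%N.
  have [->|ij] := eqVneq i j.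
    rewrite (eqP (_ : #|_| == 0%N)) ?muln0 // cards_eq0.
    by apply/eqP/setP => f; rewrite !inE eqxx andbF.
  apply: leq_trans (leq_mul QA (leqnn _)) _.
  have ut : uniq [tuple i; j] by rewrite /= inE ij.
  pose S := [set w : 2.-tuple V | [exists a in A, w == [tuple a; a]]].
  have cS : (#|S| <= #|A|)%N.
    apply: leq_trans (leq_imset_card (fun a => [tuple a; a]) A); apply: subset_leq_card.
    by apply/subsetP => w; rewrite inE => /existsP[a /andP[aA /eqP->]]; apply: imset_f.
  have := leq_trans (card_ffun_tuple_in A S ut) (leq_mul cS (leqnn _)).
  rewrite mulnC expnS -mulnA expn1 leq_pmul2l //; apply: leq_trans.
  rewrite leq_mul2l; apply/orP; right; apply/subset_leq_card/subsetP => f.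
  rewrite !inE => /and3P[fA _ /eqP fij]; rewrite fA /=; apply/existsP; exists (f i).
  by rewrite (ffun_onP fA) /=; apply/eqP/val_inj; rewrite /= -fij.
have [f fA [good1 good2 finj]] : exists2 f : {ffun 'I_N -> V}, f \in ffun_on A &
    [/\ forall t : g.+1.-tuple 'I_N, f \notin bad _ t,
        forall t : g.+2.-tuple 'I_N, f \notin bad _ t & injective f].
  apply: contrapT => nof.
  pose I : finType := ((g.+1.-tuple 'I_N + g.+2.-tuple 'I_N) + 'I_N * 'I_N)%type.
  pose F (i : I) := match i with
    | inl (inl t) => bad _ t | inl (inr t) => bad _ t | inr ij => coll ij.1 ij.2 end.
  have FE (i : I) : (Q * #|F i| <= #|A| ^ N)%N.
    case: i => [[t|t]|[i j]] /=; [exact: bad_le | exact/bad_le/unpredictableS | exact: coll_le].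
  have cI : #|I| = (N ^ g.+1 + N ^ g.+2 + N * N)%N.
    by rewrite !card_sum card_prod !card_tuple !card_ord.
  have : (#|[set f : {ffun 'I_N -> V} in ffun_on A]| <= \sum_i #|F i|)%N.
    apply: union_bound => f; rewrite inE => fA; apply: contrapT => nF.
    apply: nof; exists f => //; split=> [t|t|i j fij].
    + by apply/negP => ft; apply: nF; exists (inl (inl t)).
    + by apply/negP => ft; apply: nF; exists (inl (inr t)).
    + apply/eqP; apply: contrapT => /negP ij; apply: nF; exists (inr (i, j)).
      by rewrite inE fA ij fij eqxx.
  rewrite cardsE card_ffun_on card_ord -(leq_pmul2l (_ : 0 < Q)%N); last by lia.
  rewrite big_distrr /= => /leq_trans/(_ (leq_sum _ (fun i _ => FE i))).
  rewrite sum_nat_const leq_pmul2r ?expn_gt0 ?A0 // cI leqNgt => /negP[].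
  have le1 : (N ^ g.+1 <= N ^ g.+2)%N by rewrite leq_pexp2l.
  have le2 : (N * N <= N ^ g.+2)%N by rewrite mulnn leq_pexp2l.
  by lia.
have fX (B : {set V}) k : B \subset [set f i | i : 'I_N] -> #|B| = k.+1 ->
    (forall t : k.+1.-tuple 'I_N, f \notin bad _ t) -> robust A p k.+1 (\sum_(x in B) x).
  move=> BX cB good; apply: contrapT => nrob.
  have [_ /(_ nrob B)] := Eprop (k.+1, \sum_(x in B) x).
  have BA : B \subset A.
    by apply: subset_trans BX _; apply/subsetP => _ /imsetP[i _ ->]; apply: (ffun_onP fA).
  case/(_ BA cB erefl)/pred0Pn => b /andP[/= bE bB].
  have /imsetP[i0 _ bi0] := subsetP BX b bB.
  pose J := f @^-1: B.
  have fJ : f @: J = B.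
    apply/setP => x; apply/imsetP/idP => [[i + ->]|xB]; first by rewrite inE.
    by have /imsetP[i _ xi] := subsetP BX x xB; exists i; rewrite // inE -xi.
  have i0J : i0 \in J by rewrite inE -bi0.
  (* The block is listed with [i0] first, as [bad] concerns guessing the head of the tuple. *)
  have sJ : size (i0 :: enum (J :\ i0)) == k.+1.
    by rewrite /= -cardE -cB -fJ card_imset // (cardsD1 i0 J) i0J.
  have := good (Tuple sJ); rewrite inE fA /= => /negP[].
  rewrite enum_uniq mem_enum !inE eqxx /=; apply/existsP; exists i0; rewrite eqxx /=.
  suff -> : \sum_(i <- i0 :: enum (J :\ i0)) f i = \sum_(x in B) x by rewrite -bi0.
  rewrite -fJ big_imset /=; last by move=> ? ? _ _; apply: finj.
  by rewrite big_cons big_enum [RHS](big_setD1 i0).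
exists [set f i | i : 'I_N]; split.
- by apply/subsetP => _ /imsetP[i _ ->]; apply: (ffun_onP fA).
- by rewrite card_imset ?card_ord.
- move=> B BX /andP[]; rewrite leq_eqVlt => /orP[/eqP cB _|lt le].
    by rewrite -cB; apply: fX.
  by have cB : #|B| = g.+2 by [apply/eqP; rewrite eqn_leq lt le]; rewrite cB; apply: fX.
Qed.

End Tuples.

(** * Sumsets *)

Section Sumsets.
Variable V : finZmodType.
Implicit Types A B C Z : {set V}.

Definition sumset A B := [set a + b | a in A, b in B].

Fixpoint nsumset A k := if k is k'.+1 then sumset A (nsumset A k') else [set 0].

Lemma sumsetP A B x :
  reflect (exists a b, [/\ a \in A, b \in B & x = a + b]) (x \in sumset A B).
Proof.
apply: (iffP imset2P) => [[a b aA bB ->]|[a [b [aA bB ->]]]]; first by exists a, b.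
by exists a b.
Qed.

Lemma mem_sumset A B a b : a \in A -> b \in B -> a + b \in sumset A B.
Proof. by move=> aA bB; apply/sumsetP; exists a, b. Qed.

Lemma sumsetS A A' B B' : A \subset A' -> B \subset B' -> sumset A B \subset sumset A' B'.
Proof. by move=> sA sB; apply: imset2S. Qed.

Lemma sumsetC A B : sumset A B = sumset B A.
Proof.
apply/setP=> x; apply/sumsetP/sumsetP => -[a [b [aA bB ->]]];
  by exists b, a; rewrite addrC.
Qed.

Lemma sumsetA A B C : sumset A (sumset B C) = sumset (sumset A B) C.
Proof.
apply/setP => x; apply/sumsetP/sumsetP.
  move=> [a [_ [aA /sumsetP[b [c [bB cC ->]]] ->]]].
  by exists (a + b), c; rewrite mem_sumset // addrA.
move=> [_ [c [/sumsetP[a [b [aA bB ->]]] cC ->]]].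
by exists a, (b + c); rewrite mem_sumset // addrA.
Qed.

Lemma leq_card_sumset A B : (#|sumset A B| <= #|A| * #|B|)%N.
Proof. by rewrite /sumset curry_imset2X -cardsX leq_imset_card. Qed.

Lemma leq_card_sumset_l A B : B != set0 -> (#|A| <= #|sumset A B|)%N.
Proof.
case/set0Pn => b bB; rewrite -(card_imset A (addIr b)); apply: subset_leq_card.
by apply/subsetP => _ /imsetP[a aA ->]; apply: mem_sumset.
Qed.

Lemma leq_card_sumset_r A B : A != set0 -> (#|B| <= #|sumset A B|)%N.
Proof.
case/set0Pn => a aA; rewrite -(card_imset B (addrI a)); apply: subset_leq_card.
by apply/subsetP => _ /imsetP[b bB ->]; apply: mem_sumset.
Qed.

Lemma nsumset_neq0 A k : A != set0 -> nsumset A k != set0.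
Proof.
move=> /set0Pn[a aA]; elim: k => [|k /set0Pn[b bk]]; apply/set0Pn.
  by exists 0; rewrite inE.
by exists (a + b); apply: mem_sumset.
Qed.

Lemma leq_card_nsumset A k : A != set0 -> (#|A| <= #|nsumset A k.+1|)%N.
Proof. by move=> A0; apply/leq_card_sumset_l/nsumset_neq0. Qed.

Lemma mem_nsumset A k (w : seq V) : {subset w <= A} -> size w = k ->
  \sum_(x <- w) x \in nsumset A k.
Proof.
elim: w k => [|x w IH] [|k] //= wA; first by rewrite big_nil inE.
move=> [sw]; rewrite big_cons mem_sumset ?wA ?mem_head // IH // => y yw.
by rewrite wA // inE yw orbT.
Qed.

Lemma card_nsumset_translate A B c k : (forall a, a \in A -> a + c \in B) ->
  (#|nsumset A k| <= #|nsumset B k|)%N.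
Proof.
move=> AB; rewrite -(card_imset (nsumset A k) (addIr (c *+ k))); apply: subset_leq_card.
elim: k => [|k IH]; apply/subsetP => y /imsetP[x].
  by rewrite inE => /eqP-> ->; rewrite add0r inE.
move=> /sumsetP[a [b [aA bA xE]]] ->; rewrite xE mulrS addrACA mem_sumset ?AB //.
by apply: (subsetP IH); apply: imset_f.
Qed.

(** [Z] minimizes the ratio of [#|sumset Z B|] to [#|Z|]; the inequality is cross-multiplied to stay
    in [nat] and to cover the empty [Z']. *)
Lemma exists_min_growth A B : A != set0 -> exists Z : {set V}, [/\ Z \subset A, Z != set0 &
  forall Z' : {set V}, Z' \subset A ->
    (#|sumset Z B| * #|Z'| <= #|sumset Z' B| * #|Z|)%N].
Proof.
move=> A0; pose P (Z : {set V}) := (Z \subset A) && (Z != set0).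
pose F (Z : {set V}) := #|sumset Z B|%:R / #|Z|%:R : rat.
have PA : P A by rewrite /P subxx.
case: (Order.TotalTheory.arg_minP F PA) => Z /andP[ZA Z0] minZ; exists Z; split=> // Z' Z'A.
have [->|Z'0] := eqVneq Z' set0; first by rewrite cards0 muln0.
have := minZ Z'; rewrite /P Z'A => /(_ Z'0); rewrite /F.
rewrite ler_pdivrMr ?ltr0n ?card_gt0 // mulrAC ler_pdivlMr ?ltr0n ?card_gt0 //.
by rewrite -!natrM ler_nat.
Qed.

(** Induction on [C], removing one element [c]. Let [Z'] be the [z] whose translates [z + b + c] are
    all present already. Adding [c] creates at most [#|sumset Z B| - #|sumset Z' B|] new sums on the
    left and at least [#|Z| - #|Z'|] on the right; minimality of [Z] against [Z'] compares the
    two. *)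
Lemma petridis Z B C :
  (forall Z' : {set V}, Z' \subset Z -> (#|sumset Z B| * #|Z'| <= #|sumset Z' B| * #|Z|)%N) ->
  (#|sumset (sumset Z B) C| * #|Z| <= #|sumset Z B| * #|sumset Z C|)%N.
Proof.
move=> minZ; have [m] := ubnP #|C|; elim: m => // m IH in C *; rewrite ltnS => leC.
have [->|[c cC]] := set_0Vmem C.
  suff -> : sumset (sumset Z B) set0 = set0 by rewrite cards0.
  by apply/setP => x; rewrite inE; apply/sumsetP => -[a [b []]]; rewrite inE.
pose C' := C :\ c; have CE : C = c |: C' by rewrite setD1K.
have leC' : (#|sumset (sumset Z B) C'| * #|Z| <= #|sumset Z B| * #|sumset Z C'|)%N.
  by apply: IH; apply: leq_trans leC; rewrite [ltnRHS](cardsD1 c) cC.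
pose Z' := [set z in Z | [forall b in B, z + b + c \in sumset (sumset Z B) C']].
have Z'Z : Z' \subset Z by apply/subsetP => z; rewrite inE => /andP[].
have ZB : sumset Z' B \subset sumset Z B by apply: sumsetS.
have h1 : (#|sumset (sumset Z B) C| + #|sumset Z' B| <=
           #|sumset (sumset Z B) C'| + #|sumset Z B|)%N.
  rewrite -(cardsID (sumset Z' B) (sumset Z B)) (setIidPr ZB).
  rewrite [(#|sumset Z' B| + _)%N]addnC addnA leq_add2r.
  rewrite -(card_imset (sumset Z B :\: sumset Z' B) (addIr c)).
  apply: leq_trans (leq_card_setU _ _); apply: subset_leq_card; apply/subsetP => x.
  case/sumsetP=> y [c' [/sumsetP[z [b [zZ bB ->]]] + ->]].
  rewrite CE in_setU1 in_setU => /orP[/eqP->|c'C]; last by rewrite !mem_sumset.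
  have [//|nin] := boolP (_ \in sumset _ C'); apply/imsetP; exists (z + b) => //.
  apply/setDP; split; [exact: mem_sumset | apply: contra nin] => /sumsetP[z1 [b1 [+ b1B ->]]].
  by rewrite inE => /andP[_ /forall_inP/(_ b1 b1B)].
have h2 : (#|sumset Z C'| + #|Z| <= #|sumset Z C| + #|Z'|)%N.
  pose Zc := [set z + c | z in Z :\: Z'].
  have dis : [disjoint sumset Z C' & Zc].
    apply/pred0P => x /=; apply/negP => /andP[/sumsetP[z [c' [zZ c'C' ->]]]].
    case/imsetP => z1; rewrite !inE => /andP[+ z1Z] E; rewrite z1Z /= => /negP[].
    apply/forall_inP => b bB; rewrite addrAC -E addrAC.
    by rewrite mem_sumset ?mem_sumset.
  have sub : sumset Z C' :|: Zc \subset sumset Z C.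
    rewrite subUset sumsetS ?subD1set //=; apply/subsetP => _ /imsetP[z + ->].
    by rewrite inE => /andP[_ zZ]; apply: mem_sumset.
  have := subset_leq_card sub; rewrite cardsU disjoint_setI0 // cards0 subn0.
  rewrite card_imset; last exact: addIr.
  have := cardsID Z' Z; rewrite (setIidPr Z'Z) => <- h.
  by rewrite [(#|Z'| + _)%N]addnC addnA leq_add2r.
have h3 := minZ Z' Z'Z.
have h1' := leq_mul h1 (leqnn #|Z|).
have h2' := leq_mul (leqnn #|sumset Z B|) h2.
rewrite !mulnDl in h1'; rewrite !mulnDr in h2'.
move: leC' h3 h1' h2'; move: (_ * _)%N (_ * _)%N (_ * _)%N (_ * _)%N (_ * _)%N (_ * _)%N => *.
by lia.
Qed.

(** For the minimizer [Z], [petridis] with [C := nsumset B k] shows that each further summand [B]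
    costs a factor at most [K]. *)
Lemma plunnecke A B K k : A != set0 -> (#|sumset A B| <= K * #|A|)%N ->
  (#|nsumset B k| <= K ^ k * #|A|)%N.
Proof.
move=> A0 leK; have [Z [ZA Z0 minZ]] := exists_min_growth B A0.
have ZB : (#|sumset Z B| <= K * #|Z|)%N.
  rewrite -(@leq_pmul2r #|A|) ?card_gt0 //; apply: leq_trans (minZ A (subxx _)) _.
  by rewrite mulnAC leq_mul2r leK orbT.
suff leZ : (#|sumset Z (nsumset B k)| <= K ^ k * #|Z|)%N.
  apply: leq_trans (leq_card_sumset_r _ Z0) (leq_trans leZ _).
  by rewrite leq_mul2l subset_leq_card ?orbT.
elim: k => [|k IH].
  by rewrite expn0 mul1n (leq_trans (leq_card_sumset _ _)) // cards1 muln1.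
rewrite /= sumsetA -(@leq_pmul2r #|Z|) ?card_gt0 //.
apply: leq_trans (petridis _ _) _.
  by move=> Z' /subset_trans/(_ ZA); apply: minZ.
by apply: leq_trans (leq_mul ZB IH) _; rewrite expnS mulnACA mulnA.
Qed.

End Sumsets.

(** * Paths of length three in dense graphs *)

(** Popularity principle: the light terms, with [c * f x < m], account for at most half of the
    assumed lower bound. *)
Lemma sum_heavy (T : finType) (S : {set T}) (f : T -> nat) c m :
  (2 * (#|S| * m) <= c * \sum_(x in S) f x ->
   #|S| * m <= c * \sum_(x in [set x in S | m <= c * f x]) f x)%N.
Proof.
rewrite (big_setID [set x in S | (m <= c * f x)%N]) /= (setIidPr _); last first.
  by apply/subsetP => x; rewrite inE => /andP[].
rewrite mulnDr mul2n -addnn => /leq_trans/(_ (leq_add (leqnn _) _)) h.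
rewrite -(leq_add2r (#|S| * m)); apply: h.
rewrite big_distrr /= (leq_trans (_ : _ <= #|S :\: [set x in S | m <= c * f x]| * m)%N) //.
  rewrite -sum_nat_const; apply: leq_sum => x; rewrite !inE => /andP[+ xS].
  by rewrite xS /= -ltnNge => /ltnW.
by rewrite leq_mul2r subset_leq_card ?orbT ?subsetDl.
Qed.

Section DensePaths.
Variables (T : finType) (S : {set T}) (e : rel T) (q : nat).
Hypothesis q0 : (0 < q)%N.
Hypothesis S0 : (0 < #|S|)%N.
Hypothesis dense_e : (#|S| * #|S| <= q * \sum_(x in S) \sum_(b in S) e x b)%N.

Let n := #|S|.
Let deg x := (\sum_(b in S) e x b)%N.
Let H := [set x in S | (n <= 2 * q * deg x)%N].
Let codeg x y := (\sum_(b in S) (e x b && e y b))%N.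
Let lam := (16 * q)%N.
Let tau := (16 * q * q * lam)%N.
Let bad x y := (tau * codeg x y < n)%N.
Let nbh b := [set x in H | e x b].
Let nbad (X : {set T}) := (\sum_(x in X) \sum_(y in X) bad x y)%N.

Let HS : H \subset S.
Proof. by apply/subsetP => x; rewrite inE => /andP[]. Qed.

(** Dependent random choice: a bad pair lies in the neighbourhoods of few [b], so on average over
    the [b] with large [nbh b] these sets contain few bad pairs. *)
Let exists_nbh : exists2 b, (n <= 4 * q * #|nbh b|)%N &
  (lam * nbad (nbh b) <= #|nbh b| * #|nbh b|)%N.
Proof.
have h1 : (n * n <= 2 * q * \sum_(x in H) deg x)%N.
  by apply: sum_heavy; rewrite -mulnA leq_mul2l.
rewrite exchange_big /= in h1.
have nbhE b : (\sum_(x in H) e x b)%N = #|nbh b| by rewrite card_filter_set.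
have h2 : (n * n <= 4 * q * \sum_(b in [set b in S | n <= 4 * q * #|nbh b|]) #|nbh b|)%N.
  apply: sum_heavy; rewrite -[4%N]/(2 * 2)%N -!mulnA leq_mul2l /=.
  by apply: leq_trans h1 _; rewrite -mulnA; under eq_bigr => b _ do rewrite nbhE.
set Hb := [set b in S | _] in h2.
have [/exists_inP[b bH le]|] :=
    boolP [exists b in Hb, (lam * nbad (nbh b) <= #|nbh b| * #|nbh b|)%N].
  by exists b => //; move: bH; rewrite inE => /andP[].
rewrite negb_exists_in => /forall_inP big_bad; exfalso.
(* The [+ 1] comes from one strict inequality at [b0]. It gives the contradiction, since [tau] is
   [(4 * q) ^ 2 * lam] and all other factors cancel. *)
have h3 : (4 * q * lam * \sum_(b in Hb) nbad (nbh b) >= n * \sum_(b in Hb) #|nbh b| + 1)%N.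
  have [b0 b0H] : exists b, b \in Hb.
    apply/existsP; apply: contraLR h2 => /existsPn noH.
    by rewrite big_pred0 ?muln0 -?ltnNge ?muln_gt0 ?S0 // => b; apply/negbTE.
  rewrite !big_distrr /= (bigD1 b0) //= [leqRHS](bigD1 b0) //= addnAC leq_add //.
    rewrite addn1 -mulnA; move: (b0H); rewrite inE => /andP[_ nb].
    apply: leq_ltn_trans (leq_mul nb (leqnn _)) _.
    by rewrite -!(mulnA (4 * q)%N) ltn_pmul2l ?muln_gt0 // ltnNge big_bad.
  apply: leq_sum => b /andP[bH _]; rewrite -mulnA; move: (bH); rewrite inE => /andP[_ nb].
  apply: leq_trans (leq_mul nb (leqnn _)) _.
  by rewrite -!(mulnA (4 * q)%N) leq_pmul2l ?muln_gt0 // ltnW // ltnNge big_bad.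
have h4 : (tau * \sum_(b in Hb) nbad (nbh b) <= n * (n * n))%N.
  have nbS b : nbh b \subset S.
    by apply: subset_trans HS; apply/subsetP => x; rewrite inE => /andP[].
  have h5 : (\sum_(b in Hb) nbad (nbh b) <=
      \sum_(b in S) \sum_(x in S) \sum_(y in S) (bad x y && (e x b && e y b)))%N.
    rewrite big_mkcond [leqRHS]big_mkcond; apply: leq_sum => b _.
    case: ifP => // bH; have -> : b \in S by move: bH; rewrite inE => /andP[].
    rewrite /nbad big_mkcond [leqRHS]big_mkcond; apply: leq_sum => x _.
    case: ifP => // xb; rewrite (subsetP (nbS b) x xb).
    rewrite big_mkcond [leqRHS]big_mkcond; apply: leq_sum => y _.
    case: ifP => // yb; rewrite (subsetP (nbS b) y yb).
    by move: xb yb; rewrite !inE => /andP[_ ->] /andP[_ ->]; rewrite /= andbT.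
  apply: leq_trans (leq_mul (leqnn tau) h5) _.
  rewrite exchange_big /=; under eq_bigr => x _ do rewrite exchange_big /=.
  rewrite -sum_nat_const big_distrr /=; apply: leq_sum => x _.
  rewrite -sum_nat_const big_distrr /=; apply: leq_sum => y _.
  have [bxy|_] := boolP (bad x y); first exact: ltnW bxy.
  by rewrite big1 ?muln0.
have h5 := leq_mul (leqnn (4 * q)%N) h3.
have h6 := leq_mul (leqnn n) h2.
rewrite /tau in h4; move: h4 h5 h6.
move: (\sum_(b in Hb) nbad _)%N (\sum_(b in Hb) #|_|)%N => B C h4 h5 h6.
have h7 : (4 * q * (4 * q * lam * B) = 16 * q * q * lam * B)%N by lia.
have h8 : (n * (4 * q * C) = 4 * q * (n * C))%N by lia.
rewrite h7 mulnDr muln1 in h5; rewrite h8 in h6.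
have := leq_trans h5 (leq_trans h4 h6); rewrite -[leqRHS]addn0 leq_add2l.
by rewrite leqNgt !muln_gt0 q0.
Qed.

(** With [N] from [exists_nbh], [X] consists of its vertices in few bad pairs and [Y] of the
    vertices with many neighbours in [N]. By the choice of [lam], at least half of the neighbours
    [a] of [y] in [N] are not bad with [x], and each of them shares at least [#|S| / tau] neighbours
    [b] with [x]. *)
Lemma dense_paths : exists X Y : {set T}, [/\ X \subset S, Y \subset S,
  (#|S| <= 8 * q * #|X|)%N, (#|S| <= 4 * q * #|Y|)%N &
  forall x y, x \in X -> y \in Y ->
    (#|S| * #|S| <= 32 * 16 * 16 * q ^ 5 *
       \sum_(a in S) \sum_(b in S) [&& e x b, e a b & e a y])%N].
Proof.
have [b0 leN le_bad] := exists_nbh.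
set N := nbh b0 in leN le_bad.
have NH : N \subset H by apply/subsetP => x; rewrite inE => /andP[].
have NS := subset_trans NH HS.
have N0 : (0 < #|N|)%N.
  by apply: contraTT S0; rewrite -!leqNgt leqn0 => /eqP N0; rewrite N0 muln0 in leN.
pose nb x := (\sum_(y in N) bad x y)%N.
pose X := [set x in N | (lam * nb x <= 2 * #|N|)%N].
pose dX y := (\sum_(a in N) e a y)%N.
pose Y := [set y in S | (#|N| <= 4 * q * dX y)%N].
have XN : X \subset N by apply/subsetP => x; rewrite inE => /andP[].
exists X, Y; split.
- exact: subset_trans XN NS.
- by apply/subsetP => y; rewrite inE => /andP[].
- apply: leq_trans leN _; suff le2 : (#|N| <= 2 * #|X|)%N.
    by have := leq_mul (leqnn (4 * q)%N) le2; lia.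
  have : (\sum_(x in N :\: X) 2 * #|N| <= #|N| * #|N|)%N.
    apply: leq_trans le_bad; rewrite /nbad big_distrr /= [leqRHS](big_setID X) /=.
    apply: leq_trans (leq_addl _ _); apply: leq_sum => x; rewrite !inE => /andP[+ xN].
    by rewrite xN /= -ltnNge => /ltnW.
  rewrite sum_nat_const mulnA leq_pmul2r // => le2.
  have := cardsID X N; rewrite (setIidPr XN); lia.
- have h : (#|S| * #|N| <= 4 * q * \sum_(y in Y) dX y)%N.
    apply: sum_heavy; rewrite -[4%N]/(2 * 2)%N -!mulnA leq_mul2l /= exchange_big /=.
    rewrite mulnA big_distrr /= mulnC -sum_nat_const; apply: leq_sum => a /(subsetP NH).
    by rewrite inE => /andP[].
  rewrite -(leq_pmul2r N0); apply: leq_trans h _; rewrite -(mulnA (4 * q)%N) leq_mul2l; apply/orP; right.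
  rewrite -sum_nat_const; apply: leq_sum => y _; rewrite -sum1_card.
  by apply: leq_sum => a _; apply: leq_b1.
- move=> x y; rewrite !inE => /andP[xN lex] /andP[yS ley].
  pose P := (\sum_(a in S) \sum_(b in S) [&& e x b, e a b & e a y])%N.
  have h1 : (n * \sum_(a in N) (e a y && ~~ bad x a) <= tau * P)%N.
    rewrite !big_distrr /= big_mkcond [leqRHS]big_mkcond; apply: leq_sum => a _.
    case: ifP => // aN; rewrite (subsetP NS a aN).
    have [eay|] := boolP (e a y); last by rewrite muln0.
    have [//|gxa] := boolP (bad x a); first by rewrite muln0.
    rewrite muln1; move: gxa; rewrite -leqNgt => /leq_trans; apply.
    by rewrite leq_mul2l; apply/orP; right; apply: leq_sum => b _; rewrite andbT.
  have h2 : (dX y <= nb x + \sum_(a in N) (e a y && ~~ bad x a))%N.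
    rewrite -big_split; apply: leq_sum => a _; by case: (e a y); case: (bad x a).
  have h3 : (#|N| <= 8 * q * \sum_(a in N) (e a y && ~~ bad x a))%N.
    have := leq_mul (leqnn (8 * q)%N) h2; move: lex ley; rewrite mulnDr /lam.
    move: (nb x) (dX y) (\sum_(a in N) _)%N #|N| => B D C m; clear; lia.
  have h4 := leq_mul leN (leqnn n).
  move: h1 h3 h4; rewrite -/P /tau /lam -/n.
  move: (\sum_(a in N) _)%N => C h1 h3 h4.
  apply: leq_trans h4 _.
  apply: (@leq_trans (4 * q * (8 * q * C) * n)).
    by rewrite leq_mul2r leq_mul2l h3 !orbT.
  have := leq_mul (leqnn (32 * q * q)%N) h1; rewrite !expnS expn0 muln1.
  by move: P n C {h1 h3} => P n' C; clear; lia.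
Qed.

End DensePaths.

(** * The Balog-Szemeredi-Gowers theorem *)

Section BalogSzemerediGowers.
Variables (V : finZmodType) (T : finType) (S : {set T}) (f : T -> V).
Variables (D : {set T * T}) (q K : nat).
Let f2 (p : T * T) := f p.1 + f p.2.
Hypothesis q0 : (0 < q)%N.
Hypothesis DS : D \subset setX S S.
Hypothesis D0 : D != set0.
Hypothesis dense_D : (#|S| * #|S| <= q * #|D|)%N.
Hypothesis spread : forall X : {set T}, X \subset S ->
  (#|S| <= 2 * (32 * 16 * 16 * q ^ 5) * #|X|)%N -> (#|f2 @: D| <= K * #|f @: X|)%N.

Let R := f2 @: D.
Let c := (32 * 16 * 16 * q ^ 5)%N.
Let e x b := (x, b) \in D.

Let S0 : (0 < #|S|)%N.
Proof.
have /set0Pn[[x b] xb] := D0; rewrite card_gt0; apply/set0Pn; exists x.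
by have := subsetP DS _ xb; rewrite inE => /andP[].
Qed.

Let card_D : #|D| = (\sum_(x in S) \sum_(b in S) e x b)%N.
Proof.
rewrite pair_big_dep /= -sum1_card big_mkcond [RHS]big_mkcond; apply: eq_bigr => -[x b] _ /=.
rewrite /e; have [xbD|//] := boolP ((x, b) \in D); last by case: ifP.
by have := subsetP DS _ xbD; rewrite inE => ->.
Qed.

(* A path x - b - a - y in D writes f x + f y as an alternating sum of three elements
   of R, and the many paths joining x to y give many such representations. *)
Let card_representations x y :
  (#|S| * #|S| <= c * \sum_(a in S) \sum_(b in S) [&& e x b, e a b & e a y])%N ->
  (#|R| * #|R| <= K * K * #|[set t in setX (setX R R) R |
     (t.1.1 - t.1.2 + t.2 == f x + f y)%R]|)%N.
Proof.
rewrite exchange_big /= => dense.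
pose zeta b := (\sum_(a in S) [&& e x b, e a b & e a y])%N.
pose B := [set b in S | (#|S| <= 2 * c * zeta b)%N].
have BS : B \subset S by apply/subsetP => b; rewrite inE => /andP[].
have B_dense : (#|S| <= 2 * c * #|B|)%N.
  have h : (#|S| * #|S| <= 2 * c * \sum_(b in B) zeta b)%N.
    by apply: sum_heavy; rewrite -mulnA leq_mul2l.
  rewrite -(leq_pmul2r S0); apply: leq_trans h _; rewrite -(mulnA (2 * c)%N) leq_mul2l.
  apply/orP; right; rewrite -sum_nat_const; apply: leq_sum => b _.
  by rewrite -sum1_card; apply: leq_sum => a _; apply: leq_b1.
pose Z b := [set a in S | [&& e x b, e a b & e a y]].
have Z_dense b : b \in B -> (#|S| <= 2 * c * #|Z b|)%N.
  by rewrite inE card_filter_set => /andP[].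
have ZS b : Z b \subset S by apply/subsetP => a; rewrite inE => /andP[].
have [x0 _] : exists x0 : T, x0 \in S by apply/set0Pn; rewrite -card_gt0.
(* One preimage in [B] is fixed for each value [v], since representations are counted by values
   rather than by indices. *)
pose g v := odflt x0 [pick b in B | f b == v].
have gP v : v \in f @: B -> g v \in B /\ f (g v) = v.
  case/imsetP=> b bB ->; rewrite /g; case: pickP => [b' /andP[b'B /eqP]//|/(_ b)].
  by rewrite bB eqxx.
pose P := [set p in setX (f @: B) [set: V] | p.2 \in f @: Z (g p.1)].
have cP : #|P| = (\sum_(v in f @: B) #|f @: Z (g v)|)%N.
  rewrite -sum1_card (eq_bigr (fun v => \sum_(w in f @: Z (g v)) 1)%N) => [|v _]; last by rewrite sum1_card.
  by rewrite pair_big_dep /=; apply: eq_bigl => -[v w]; rewrite !inE andbT.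
apply: (@leq_trans (K * K * #|P|)).
  apply: (@leq_trans (K * #|f @: B| * #|R|)); first by rewrite leq_mul2r spread ?orbT.
  rewrite -!mulnA leq_mul2l cP big_distrr -sum_nat_const leq_sum ?orbT // => v /gP[gB _].
  by apply: spread => //; apply: Z_dense.
rewrite leq_mul2l; apply/orP; right.
(* The triple determines [v] and [w], because [f x] and [f y] are fixed. *)
pose phi (p : V * V) := ((f x + p.1, p.2 + p.1), p.2 + f y).
rewrite -(card_imset P (f := phi)); last first.
  by move=> [v w] [v' w'] [/addrI-> _ /addIr->].
apply: subset_leq_card; apply/subsetP => _ /imsetP[[v w] + ->].
rewrite !inE /= andbT => /andP[/gP[gB gv] /imsetP[a + ->]].
rewrite inE => /and4P[aS xb ab ay].
have fR p : p \in D -> f2 p \in R by apply: imset_f.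
have xv : f x + v \in R by rewrite -gv; apply: fR xb.
have av : f a + v \in R by rewrite -gv; apply: fR ab.
rewrite xv av (fR _ ay) /=.
by rewrite opprD [X in X + _]addrACA subrr addr0 addrA subrK.
Qed.

(** Each sum [f x + f y] is represented by at least [#|R| ^ 2 / K ^ 2] triples from [R], and
    different sums use different triples among the [#|R| ^ 3] available. *)
Lemma balog_szemeredi_gowers : exists X Y : {set T}, [/\ X \subset S, Y \subset S,
  (#|S| <= 8 * q * #|X|)%N, (#|S| <= 4 * q * #|Y|)%N &
  (#|sumset (f @: X) (f @: Y)| <= K * K * #|R|)%N].
Proof.
have := dense_D; rewrite card_D => dense.
have [X [Y [XS YS leX leY paths]]] := dense_paths q0 S0 dense.
exists X, Y; split=> //; set W := sumset _ _.
have R0 : (0 < #|R| * #|R|)%N.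
  have /set0Pn[p pD] := D0; rewrite muln_gt0 andbb card_gt0; apply/set0Pn.
  by exists (f2 p); apply: imset_f.
rewrite -(leq_pmul2r R0).
pose Tr v := [set t in setX (setX R R) R | t.1.1 - t.1.2 + t.2 == v].
apply: (@leq_trans (K * K * \sum_(v in W) #|Tr v|)).
  rewrite -sum_nat_const big_distrr /=; apply: leq_sum => v.
  case/sumsetP=> _ [_ [/imsetP[x xX ->] /imsetP[y yY ->] ->]].
  by apply: card_representations; apply: paths.
rewrite -!mulnA !leq_mul2l; apply/orP; right; apply/orP; right.
rewrite mulnA -!cardsX -sum1_card.
under eq_bigr => v _ do rewrite card_filter_set.
rewrite exchange_big; apply: leq_sum => t _ /=.
have [tW|tW] := boolP (t.1.1 - t.1.2 + t.2 \in W); last first.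
  by rewrite big1 // => v vW; case: eqP => // E; rewrite -E (negbTE tW) in vW.
rewrite (bigD1 _ tW) /= eqxx big1 // => v /andP[_ /negbTE]; rewrite eq_sym => ->.
by [].
Qed.

End BalogSzemerediGowers.

(** * Sums over binary trees *)

Section Trees.
Variable V : finZmodType.
Implicit Types A : {set V}.

(** Summing [2 ^ h] elements along a binary tree makes each sum at level [h.+1] a sum of two at
    level [h], the shape needed for [balog_szemeredi_gowers]. *)
Fixpoint tree h : finType := if h is h'.+1 then (tree h' * tree h')%type else V.

Fixpoint tree_sum h : tree h -> V :=
  if h is h'.+1 then fun t => tree_sum t.1 + tree_sum t.2 else id.

Fixpoint trees_in A h : {set tree h} :=
  if h is h'.+1 then setX (trees_in A h') (trees_in A h') else A.

(* If some dense X at level h has K times fewer sums than D, recurse on X; since the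
   number of sums drops by a factor K each time, this stops before level 0. *)
Lemma exists_spread_level A K h q (D : {set tree h}) :
  (1 < q)%N -> D \subset trees_in A h -> (#|trees_in A h| <= q * #|D|)%N -> D != set0 ->
  (#|@tree_sum h @: D| < K ^ h)%N ->
  exists i q' (D' : {set tree i.+1}),
  [/\ [/\ (1 < q')%N, (q' <= q ^ (20 ^ h))%N, D' \subset trees_in A i.+1 & D' != set0],
    (#|trees_in A i.+1| <= q' * #|D'|)%N,
    (#|@tree_sum i.+1 @: D'| <= #|@tree_sum h @: D|)%N &
    forall X : {set tree i}, X \subset trees_in A i -> (#|trees_in A i| <= q' ^ 20 * #|X|)%N ->
      (#|@tree_sum i.+1 @: D'| <= K * #|@tree_sum i @: X|)%N].
Proof.
elim: h q D => [|h IH] q D q1 DA dense D0 ltK.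
  by move: ltK; rewrite expn0 ltnS leqn0 cards_eq0 imset_eq0 (negbTE D0).
have [spread|] := pselect (forall X : {set tree h}, X \subset trees_in A h ->
    (#|trees_in A h| <= q ^ 20 * #|X|)%N ->
    (#|@tree_sum h.+1 @: D| <= K * #|@tree_sum h @: X|)%N).
  exists h, q, D; split=> //; split=> //.
  by rewrite -[leqLHS]expn1 leq_pexp2l ?expn_gt0 // ltnW.
case/existsNP => X /not_implyP[XA] /not_implyP[denseX] /negP; rewrite -ltnNge => ltX.
have q20 : (1 < q ^ 20)%N by rewrite -(exp1n 20) ltn_exp2r.
have X0 : X != set0.
  apply: contraTneq denseX => ->; rewrite cards0 muln0 -ltnNge card_gt0.
  have /set0Pn[[x y] /(subsetP DA)] := D0; rewrite inE => /andP[xA _].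
  by apply/set0Pn; exists x.
have K0 : (0 < K)%N by move: ltK; case: (K) => // ; rewrite exp0n.
have [|i [q' [D' [[q'1 leq' D'A D'0] dense' le' spread']]]] := IH _ X q20 XA denseX X0.
  by rewrite -(ltn_pmul2l K0) -expnS (ltn_trans ltX).
exists i, q', D'; split=> //; first by split=> //; rewrite expnS expnM.
apply: leq_trans le' _; apply: leq_trans (ltnW ltX); exact: leq_pmull.
Qed.

(** By averaging, the right subtree can be fixed at every level without losing density; only the
    leftmost leaf varies, and the fixed subtrees add up to [c]. *)
Lemma exists_tree_fiber A q h (X : {set tree h}) :
  A != set0 -> X \subset trees_in A h -> (#|trees_in A h| <= q * #|X|)%N ->
  exists A' c, [/\ A' \subset A, (#|A| <= q * #|A'|)%N &
    forall a, a \in A' -> a + c \in @tree_sum h @: X].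
Proof.
move=> A0; have S0 i : (0 < #|trees_in A i|)%N.
  by elim: i => [|i IH] /=; [rewrite card_gt0 | rewrite cardsX muln_gt0 IH].
elim: h X => [|h IH] X XA dense.
  by exists X, 0; split=> // a aX; rewrite addr0; apply/imsetP; exists a.
pose Xy y := [set x in trees_in A h | (x, y) \in X].
have cX : #|X| = (\sum_(y in trees_in A h) #|Xy y|)%N.
  under eq_bigr => y _ do rewrite card_filter_set.
  rewrite exchange_big pair_big_dep /= -sum1_card big_mkcond [RHS]big_mkcond.
  apply: eq_bigr => -[x b] _ /=; have [xbD|] := boolP ((x, b) \in X); last by case: ifP.
  by have := subsetP XA _ xbD; rewrite inE => ->.
have [y yS dy] : exists2 y, y \in trees_in A h & (#|trees_in A h| <= q * #|Xy y|)%N.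
  apply/exists_inP; apply: contraLR dense; rewrite negb_exists_in => /forall_inP lt.
  rewrite -ltnNge /= cardsX cX big_distrr /= -sum_nat_const.
  have /set0Pn[y0 y0S] : trees_in A h != set0 by rewrite -card_gt0.
  rewrite (bigD1 y0) //= [ltnRHS](bigD1 y0) //= -addSn leq_add ?ltnNge ?lt //.
  by apply: leq_sum => y /andP[yS _]; rewrite ltnW // ltnNge lt.
have [|A' [c [A'A dA' A'c]]] := IH (Xy y) _ dy.
  by apply/subsetP => x; rewrite inE => /andP[].
exists A', (c + tree_sum y); split=> // a aA'; rewrite addrA.
have /imsetP[x + ->] := A'c a aA'; rewrite inE => /andP[_ xy].
by apply/imsetP; exists (x, y).
Qed.

(** At a spread level, [balog_szemeredi_gowers] gives [X], [Y] with [#|sumset (f @: X) (f @: Y)|] at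
    most [K ^ 3 * #|f @: Y|]. Then [plunnecke] bounds the iterated sumsets of [f @: X], which
    contains a translate of a dense [A']. *)
Lemma exists_small_sumset A K h l q (D : {set tree h}) :
  (1 < q)%N -> D \subset trees_in A h -> (#|trees_in A h| <= q * #|D|)%N -> D != set0 ->
  (#|@tree_sum h @: D| < K ^ h)%N ->
  exists A' : {set V}, [/\ A' \subset A, (#|A| <= q ^ (20 ^ h.+1) * #|A'|)%N &
    (#|nsumset A' l| <= K ^ (3 * l + 2) * #|@tree_sum h @: D|)%N].
Proof.
move=> q1 DA dense D0 ltK.
have A0 : A != set0.
  have /set0Pn[t /(subsetP DA)] := D0; elim: h t {D DA dense D0 ltK} => [|h IH] t /=.
    by move=> tA; apply/set0Pn; exists t.
  by rewrite inE => /andP[/IH].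
have [i [q' [D' [[q'1 leq' D'A D'0] dense' le' spread]]]] :=
  exists_spread_level q1 DA dense D0 ltK.
have q'0 : (0 < q')%N by apply: ltnW.
(* As [2 <= q'], the power [q' ^ 15] exceeds the numerical constant [2 ^ 14]. *)
have q20 : (2 * (32 * 16 * 16 * q' ^ 5) <= q' ^ 20)%N.
  have -> : (q' ^ 20 = q' ^ 15 * q' ^ 5)%N by rewrite -expnD.
  rewrite mulnA leq_mul2r; apply/orP; right.
  by apply: (@leq_trans (2 ^ 15)); rewrite ?leq_exp2r // -!expnD.
have le20 m : (m <= 8)%N -> (m * q' <= q' ^ 20)%N.
  move=> m8; rewrite expnSr leq_mul2r; apply/orP; right; apply: leq_trans m8 _.
  by apply: (@leq_trans (2 ^ 19)) => //; rewrite leq_exp2r.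
set S := trees_in A i in spread; pose f := @tree_sum i.
rewrite /= cardsX in dense'.
have [X [Y [XS YS denseX denseY leXY]]] :
    exists X Y : {set tree i}, [/\ X \subset S, Y \subset S,
      (#|S| <= q' ^ 20 * #|X|)%N, (#|S| <= q' ^ 20 * #|Y|)%N &
      (#|sumset (f @: X) (f @: Y)| <= K * K * #|@tree_sum i.+1 @: D'|)%N].
  have [|X [Y [XS YS denseX denseY leXY]]] :=
      @balog_szemeredi_gowers V (tree i) S f D' q' K q'0 D'A D'0 dense' _.
    by move=> X XS dX; apply: spread => //; apply: leq_trans dX _; rewrite leq_mul2r q20 orbT.
  exists X, Y; split=> //.
    by apply: leq_trans denseX _; rewrite leq_mul2r le20 ?orbT.
  by apply: leq_trans denseY _; rewrite leq_mul2r le20 ?orbT.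
have [A' [c [A'A dA' A'c]]] := exists_tree_fiber A0 XS denseX.
have S0 : (0 < #|S|)%N.
  have /set0Pn[[x y] /(subsetP D'A)] := D'0; rewrite inE card_gt0 => /andP[xS _].
  by apply/set0Pn; exists x.
have Y0 : f @: Y != set0.
  by rewrite imset_eq0; apply: contraTneq denseY => ->; rewrite cards0 muln0 -ltnNge.
have X0 : f @: X != set0.
  by rewrite imset_eq0; apply: contraTneq denseX => ->; rewrite cards0 muln0 -ltnNge.
have leYX : (#|sumset (f @: Y) (f @: X)| <= K ^ 3 * #|f @: Y|)%N.
  rewrite sumsetC (leq_trans leXY) // !expnS expn0 muln1 [(K * (K * K))%N]mulnA -[leqRHS]mulnA.
  by rewrite leq_mul2l spread ?orbT.
exists A'; split=> //.
  apply: leq_trans dA' _; rewrite leq_mul2r; apply/orP; right.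
  by rewrite (expnSr 20) expnM leq_exp2r.
apply: leq_trans (card_nsumset_translate l A'c) _.
apply: leq_trans (plunnecke l Y0 leYX) _.
rewrite expnD expnM -!mulnA leq_mul2l; apply/orP; right.
apply: leq_trans (leq_card_sumset_r _ X0) _; apply: leq_trans leXY _.
by rewrite mulnA leq_mul2l le' orbT.
Qed.

End Trees.

(** * Regularization *)

Section Regularize.
Variable V : finZmodType.
Implicit Types A : {set V}.

(** For many [a], a dense set [W a] of tuples lets [a] be guessed. Each sum over [W a] yields [u] in
    [nsumset A k.+1] with [a \in E u], and each [u] serves at most [M] values of [a]; so some [a]
    has few such sums. *)
Lemma predictable_small_sums A k M Q :
  A != set0 -> ~ unpredictable A k M Q ->
  exists W : {set k.-tuple V}, [/\ W \subset tuples_in A k, (#|A| ^ k <= 2 * Q * #|W|)%N &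
    (#|[set (\sum_(x <- tval w) x)%R | w in W]| * #|A| <= 2 * Q * M * #|nsumset A k.+1|)%N].
Proof.
move=> A0 /existsNP[E] /not_implyP[leE] /negP; rewrite -ltnNge => big.
have cA : (0 < #|A|)%N by rewrite card_gt0.
pose W a := [set w in tuples_in A k | a \in E (a + \sum_(x <- w) x)].
pose D := [set a in A | (#|A| ^ k <= 2 * Q * #|W a|)%N].
have leD : (#|A| <= 2 * Q * #|D|)%N.
  have h : (#|A| * #|A| ^ k <= 2 * Q * \sum_(a in D) #|W a|)%N.
    apply: sum_heavy; rewrite -mulnA leq_mul2l /= -expnS.
    by under eq_bigr => a _ do rewrite card_filter_set; apply: ltnW.
  rewrite -(@leq_pmul2r (#|A| ^ k)) ?expn_gt0 ?cA //; apply: leq_trans h _.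
  rewrite -(mulnA (2 * Q)%N) leq_mul2l; apply/orP; right.
  rewrite -sum_nat_const; apply: leq_sum => a _; rewrite -card_tuples_in.
  by apply: subset_leq_card; apply/subsetP => w; rewrite inE => /andP[].
pose sW a := [set \sum_(x <- tval w) x | w in W a].
have leS : (\sum_(a in D) #|sW a| <= M * #|nsumset A k.+1|)%N.
  apply: (@leq_trans (\sum_(a in D) #|[set u in nsumset A k.+1 | a \in E u]|)).
    apply: leq_sum => a; rewrite inE => /andP[aA _].
    rewrite -(card_imset (sW a) (addrI a)); apply: subset_leq_card.
    apply/subsetP => _ /imsetP[_ /imsetP[w + ->] ->]; rewrite !inE => /andP[/allP wA aE].
    by rewrite aE andbT mem_sumset // mem_nsumset ?size_tuple.
  under eq_bigr => a _ do rewrite card_filter_set.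
  rewrite exchange_big /= mulnC -sum_nat_const; apply: leq_sum => u _.
  apply: leq_trans (leE u); rewrite -sum1_card big_mkcond [leqRHS]big_mkcond.
  by apply: leq_sum => a _; case: (a \in D); case: (a \in E u).
have [/exists_inP[a aD le]|] :=
    boolP [exists a in D, (#|sW a| * #|A| <= 2 * Q * M * #|nsumset A k.+1|)%N].
  exists (W a); split=> //; first by apply/subsetP => w; rewrite inE => /andP[].
  by move: aD; rewrite inE => /andP[].
rewrite negb_exists_in => /forall_inP lt; exfalso.
have [a0 a0D] : exists a, a \in D.
  by apply/set0Pn; apply: contraTneq leD => ->; rewrite cards0 muln0 -ltnNge.
have : (#|D| * (2 * Q * M * #|nsumset A k.+1|) < \sum_(a in D) #|sW a| * #|A|)%N.
  rewrite -sum_nat_const (bigD1 a0) //= [ltnRHS](bigD1 a0) //= -addSn leq_add //.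
    by rewrite ltnNge lt.
  by apply: leq_sum => a /andP[aD _]; rewrite ltnW // ltnNge lt.
rewrite -big_distrl /= ltnNge => /negP[]; apply: leq_trans (leq_mul leS leD) _.
by rewrite leq_eqVlt; apply/orP; left; apply/eqP;
   move: #|D| #|nsumset _ _| => d s; clear; lia.
Qed.

Fixpoint leaves h : tree V h -> seq V :=
  if h is h'.+1 then fun t => leaves t.1 ++ leaves t.2 else fun t => [:: t].

Lemma exists_leaves h (s : seq V) : size s = (2 ^ h)%N -> exists t : tree V h, leaves t = s.
Proof.
elim: h s => [|h IH] s /=; first by case: s => [|x []] // _; exists x.
move=> ss; have [|t1 E1] := IH (take (2 ^ h) s).
  by rewrite size_takel // ss leq_exp2l.
have [|t2 E2] := IH (drop (2 ^ h) s).
  by rewrite size_drop ss expnS mul2n -addnn addnK.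
by exists (t1, t2); rewrite /= E1 E2 cat_take_drop.
Qed.

Lemma sum_leaves h (t : tree V h) : \sum_(x <- leaves t) x = tree_sum t.
Proof. by elim: h t => [|h IH] t /=; rewrite ?big_seq1 // big_cat !IH. Qed.

Lemma all_leaves A h (t : tree V h) : all [in A] (leaves t) = (t \in trees_in A h).
Proof. by elim: h t => [|h IH] t /=; rewrite ?andbT // all_cat !IH inE. Qed.

Lemma card_trees_in A h : #|trees_in A h| = (#|A| ^ (2 ^ h))%N.
Proof.
elim: h => [|h IH] /=; first by rewrite expn0 expn1.
by rewrite cardsX IH expnS mul2n -addnn expnD.
Qed.

Lemma trees_of_tuples A h (W : {set (2 ^ h).-tuple V}) : W \subset tuples_in A (2 ^ h) ->
  exists D : {set tree V h}, [/\ D \subset trees_in A h, #|D| = #|W| &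
    @tree_sum V h @: D = [set \sum_(x <- tval w) x | w in W]].
Proof.
move=> WA; have /choice[g gE] (w : (2 ^ h).-tuple V) : exists t : tree V h, leaves t = w.
  by apply: exists_leaves; rewrite size_tuple.
have ginj : injective g by move=> w w' E; apply: val_inj; rewrite /= -!gE E.
exists (g @: W); split; last 2 first.
- exact: card_imset.
- by rewrite -imset_comp; apply: eq_imset => w /=; rewrite -sum_leaves gE.
- apply/subsetP => _ /imsetP[w wW ->]; rewrite -all_leaves gE.
  by have := subsetP WA w wW; rewrite inE.
Qed.

End Regularize.

(* Induction on m: a predictable A is replaced by a subset A1 for which |nsumset|^2
   loses a factor of about |A|. All losses are powers of K, where K is about
   |A|^(1/b), and b, h, x are chosen so that the total loss is at most |A|. *)
Lemma exists_unpredictable_subset m : exists g L, (0 < L)%N /\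
  forall (V : finZmodType) (A : {set V}) (Q M : nat),
  (1 < Q)%N -> (M <= Q)%N -> (Q ^ L <= #|A|)%N -> (#|nsumset A g.+1| ^ 2 <= #|A| ^ m)%N ->
  exists A' : {set V}, [/\ A' \subset A, (Q <= #|A'|)%N & unpredictable A' g M Q].
Proof.
elim: m => [|m [g [L [L0 IH]]]].
  exists 0%N, 1%N; split=> // V A Q M Q1 _; rewrite expn1 => QA.
  have A0 : A != set0 by rewrite -card_gt0 (leq_trans _ QA) // ltnW.
  rewrite expn0 leqNgt => /negP[]; apply: leq_trans (_ : _ <= #|A| ^ 2)%N _.
    by apply: leq_trans (_ : _ <= 2 ^ 2)%N _; rewrite // leq_exp2r // (leq_trans Q1).
  by rewrite leq_exp2r // leq_card_nsumset.
(* [K ^ b <= #|A|] will pay for the loss in [nsA1]; [h] ensures [#|A| ^ m < K ^ h], via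
   [#|A| < K.+1 ^ b <= K ^ (2 * b)]; [x] makes every power of [Q] that occurs at most
   [Q ^ x <= K]. *)
pose b := (6 * g + 16 + m)%N; pose h := (2 * b * m + g + 1)%N.
pose k := (2 ^ h)%N; pose x := (2 * 20 ^ h.+1 + L + 6)%N.
have b1 : (1 < b)%N by rewrite /b; lia.
have x0 : (0 < x)%N by rewrite /x addnS.
have xb0 : (0 < x * b)%N by rewrite muln_gt0 x0 ltnW.
exists k, (x * b)%N; split=> // V A Q M Q1 MQ QA nsA.
have Q0 : (0 < Q)%N by apply: ltnW.
have leQ i : (i <= x)%N -> (Q ^ i <= Q ^ x)%N by apply: leq_pexp2l.
have QA1 : (Q <= #|A|)%N by apply: leq_trans QA; rewrite -[leqLHS]expn1 leq_pexp2l.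
have A0 : A != set0 by rewrite -card_gt0 (leq_trans _ QA1).
have [unp|npred] := pselect (unpredictable A k M Q); first by exists A.
have [W [WA dW sW]] := predictable_small_sums A0 npred.
have [D [DA cD sD]] := trees_of_tuples WA.
(* [K] is the integer part of the [b]-th root of [#|A|]. *)
have [K KA AK] : exists2 K, (K ^ b <= #|A|)%N & (#|A| < K.+1 ^ b)%N.
  have exK : exists K, (K ^ b <= #|A|)%N by exists 0%N; rewrite exp0n // ltnW.
  have ubK K : (K ^ b <= #|A|)%N -> (K <= #|A|)%N.
    by apply: leq_trans; case: K => // K; rewrite -[leqLHS]expn1 leq_pexp2l // ltnW.
  case: (ex_maxnP exK ubK) => K KA maxK; exists K => //.
  by rewrite ltnNge; apply/negP => /maxK; rewrite ltnn.
have QK : (Q ^ x <= K)%N.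
  rewrite -ltnS -(@ltn_exp2r _ _ b) ?(ltnW b1) // -expnM.
  exact: leq_ltn_trans QA AK.
have K1 : (1 < K)%N by apply: leq_trans QK; rewrite -(exp1n x) ltn_exp2r.
have K0 : (0 < K)%N by apply: ltnW.
pose Nw := #|@tree_sum V h @: D|; pose ns := #|nsumset A k.+1|.
have leNA : (Nw * #|A| <= Q ^ 3 * ns)%N.
  rewrite /Nw sD; apply: leq_trans sW _; rewrite leq_mul2r; apply/orP; right.
  by rewrite -mulnA expnS leq_mul // expnS expn1 leq_mul.
have leNA2 : ((Nw * #|A|) ^ 2 <= K * #|A| ^ m.+1)%N.
  apply: (@leq_trans ((Q ^ 3 * ns) ^ 2)); first by rewrite leq_exp2r.
  rewrite expnMn leq_mul // -expnM; apply: leq_trans QK; apply: leQ.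
  by rewrite /x leq_addl.
have KleA : (K <= #|A|)%N.
  by apply: leq_trans KA; rewrite -[leqLHS]expn1 leq_pexp2l // ltnW.
have cA : (0 < #|A|)%N by rewrite card_gt0.
have ltN : (Nw < K ^ h)%N.
  have leN2 : (Nw ^ 2 <= #|A| ^ m)%N.
    rewrite -(@leq_pmul2r (#|A| ^ 2)) ?expn_gt0 ?cA // -expnMn.
    by apply: leq_trans leNA2 _; rewrite -expnD addn2 [leqRHS]expnS leq_mul2r KleA orbT.
  have leN : (Nw <= #|A| ^ m)%N.
    rewrite -(@leq_exp2r _ _ 2) //; apply: leq_trans leN2 _.
    by rewrite -[leqLHS]expn1 leq_pexp2l // expn_gt0 cA.
  apply: leq_ltn_trans leN _; apply: (@leq_ltn_trans (K ^ (2 * b * m))).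
    rewrite expnM [in leqRHS]expnM; case: (m) => // m'; rewrite leq_exp2r //.
    apply: leq_trans (ltnW AK) _; rewrite leq_exp2r ?(ltnW b1) //.
    by rewrite expnS expn1; apply: (@leq_trans (2 * K)); [lia | rewrite leq_mul2r K1 orbT].
  by rewrite ltn_exp2l // /h -addnA addn1 -addSnnS leq_addr.
have Q2 : (1 < Q ^ 2)%N by rewrite -(exp1n 2) ltn_exp2r.
have dD : (#|trees_in A h| <= Q ^ 2 * #|D|)%N.
  by rewrite card_trees_in cD; apply: leq_trans dW _; rewrite leq_mul2r expnS expn1 leq_mul2r Q1 !orbT.
have D0 : D != set0.
  by apply: contraTneq dD => ->; rewrite cards0 muln0 -ltnNge card_trees_in expn_gt0 cA.
have [A1 [A1A leA1 sA1]] := exists_small_sumset g.+1 Q2 DA dD D0 ltN.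
have {}leA1 : (#|A| <= K * #|A1|)%N.
  apply: leq_trans leA1 _; rewrite leq_mul2r; apply/orP; right.
  by rewrite -expnM; apply: leq_trans QK; apply: leQ; rewrite /x -addnA leq_addr.
have QA1' : (Q ^ L <= #|A1|)%N.
  apply: (@leq_trans K).
    by apply: leq_trans QK; apply: leQ; rewrite /x addnAC leq_addl.
  rewrite -(leq_pmul2l K0); apply: leq_trans leA1; apply: leq_trans KA.
  by rewrite mulnn leq_pexp2l.
(* [leNA2] gains a factor [#|A| ^ 2]: one [#|A|] lowers the exponent, the other pays for
   [K ^ (6 * g + 11 + m) <= K ^ b]. *)
have nsA1 : (#|nsumset A1 g.+1| ^ 2 <= #|A1| ^ m)%N.
  rewrite -(@leq_pmul2r (#|A| ^ 2)) ?expn_gt0 ?cA // -expnMn.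
  apply: (@leq_trans ((K ^ (3 * g.+1 + 2) * Nw * #|A|) ^ 2)).
    by rewrite leq_exp2r // leq_mul2r sA1 orbT.
  rewrite -mulnA expnMn -expnM.
  apply: leq_trans (leq_mul (leqnn _) leNA2) _.
  rewrite mulnA -expnSr (expnS #|A| m) [(#|A| * _)%N]mulnC mulnA.
  have leAm : (#|A| ^ m <= K ^ m * #|A1| ^ m)%N.
    by rewrite -expnMn; case: (m) => // m'; rewrite leq_exp2r.
  rewrite (expnS #|A| 1) expn1 mulnA leq_mul2r; apply/orP; right.
  apply: leq_trans (leq_mul (leqnn _) leAm) _.
  rewrite mulnA -expnD mulnC leq_mul2l; apply/orP; right.
  by apply: leq_trans KA; rewrite leq_pexp2l // /b; lia.
have [A2 [A2A1 QA2 unp]] := IH V A1 Q M Q1 MQ QA1' nsA1.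
exists A2; split=> //; first exact: subset_trans A2A1 A1A.
apply: unpredictable_leq unp; apply: leq_trans (ltnW (ltn_expl h (isT : (1 < 2)%N))).
by rewrite /h addn1 leqW // leq_addl.
Qed.

(** * The theorem *)

(** The exponent [2 * t] works because any sumset has at most [p ^ n <= #|A| ^ t] elements. The
    number of guesses is [p], as blocking sets have fewer than [p] elements. *)
Lemma exists_zero_sum_of_large t : exists G L : nat, [/\ (0 < G)%N, (0 < L)%N &
  forall p n (A : {set 'rV['F_p]_n}) (N Q : nat), prime p -> (G ^ 2 <= p)%N ->
    ((2 * p + 1) * (2 * 2 ^ (n + n * G)) < N)%N -> (3 * N ^ G.+1 < Q)%N -> (p <= Q)%N ->
    (Q ^ L <= #|A|)%N -> (p ^ n <= #|A| ^ t)%N -> has_distinct_zero_sum A].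
Proof.
have [g [L [L0 unpP]]] := exists_unpredictable_subset (2 * t).
exists g.+1, L; split=> // p n A N Q p_pr Gp ltN ltQ pQ QA pA.
have N0 : (0 < N)%N by apply: leq_ltn_trans ltN.
have [||A' [A'A QA' unp]] := unpP _ A Q p _ pQ QA.
- by apply: leq_trans pQ; apply: prime_gt1.
- rewrite mulnC expnM leq_exp2r //; apply: leq_trans (max_card _) _.
  by rewrite card_mx mul1n card_Fp.
have [X [XA' cX rob]] := exists_robust_subset N0 ltQ QA' unp.
have [|x [xinj xA' x0]] := @zero_sum_of_robust p n g.+1 A' X p_pr isT Gp _ rob.
  by rewrite cX.
by exists x; split=> // i; apply: (subsetP A'A).
Qed.

Theorem theorem1p2 (R : realType) (eps : R) (heps : 0 < eps) :
  exists C : R,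
    forall p : nat, prime p ->
      exists D : R,
        forall n : nat, (0 < n)%N ->
          forall A : {set 'rV['F_p]_n},
            ~ has_distinct_zero_sum A ->
            (#|A|%:R : R) <= D * (C * p%:R `^ eps) ^+ n.
Proof.
(* As [t] is at least [1 / eps], the inequality [#|A| ^ t < p ^ n] alone gives the desired bound on
   [#|A|]. *)
pose t := Num.bound eps^-1.
have tP : 1 <= eps * t%:R.
  rewrite -ler_pdivrMl // mulr1 ltW //; apply: archi_boundP.
  by rewrite invr_ge0 ltW.
have [G [L [G0 L0 zsP]]] := exists_zero_sum_of_large t.
(* [B] and [C0] are the growth rates in [n] of [N] and [Q ^ L] below; [G ^ 2] covers the primes
   [p < G ^ 2], where [#|A| <= p ^ n] suffices. *)
pose B := (2 ^ G.+1)%N; pose C0 := ((B ^ G.+1) ^ L)%N; pose C := (G ^ 2 + C0)%N.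
have C00 : (0 < C0)%N by rewrite !expn_gt0.
exists C%:R => p p_pr; pose P := (p%:R : R) `^ eps.
have p0 := prime_gt0 p_pr.
have P1 : 1 <= P.
  rewrite -(powRr0 (p%:R : R)) /P ler_powR ?ler1n // ltW //.
(* [c] and [q] absorb all dependence on [p] outside [P]: [c] exceeds [2 * (2 * p + 1)] by one, the 4
   in [q] beats the 3 in [ltQ], and its factor [p] gives [pQ]. *)
pose c := (2 * (2 * p + 1) + 1)%N; pose q := (4 * c ^ G.+1 * p)%N.
have c0 : (0 < c)%N by rewrite /c addn1.
have q0 : (0 < q)%N by rewrite /q !muln_gt0 expn_gt0 c0 p0.
exists (q ^ L)%:R => n n0 A nzs.
have leDC (y : R) : y <= (C%:R * P) ^+ n -> y <= (q ^ L)%:R * (C%:R * P) ^+ n.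
  move=> /le_trans; apply; rewrite ler_peMl ?exprn_ge0 ?mulr_ge0 ?ler0n ?(le_trans ler01) //.
  by rewrite ler1n expn_gt0 q0.
have C1 : 1 <= C%:R :> R by rewrite ler1n /C addn_gt0 C00 orbT.
have [Gp|pG] := leqP (G ^ 2) p; last first.
  apply: leDC; apply: (@le_trans _ _ (C%:R ^+ n)).
    rewrite -natrX ler_nat; apply: leq_trans (max_card _) _.
    rewrite card_mx mul1n card_Fp // leq_exp2r //.
    by apply: leq_trans (ltnW pG) _; apply: leq_addr.
  by rewrite lerXn2r ?nnegrE ?mulr_ge0 ?ler0n ?ler_peMr // (le_trans ler01).
pose N := (c * B ^ n)%N; pose Q := (q * (B ^ G.+1) ^ n)%N.
have Bn0 : (0 < B ^ n)%N by rewrite !expn_gt0.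
have ltN : ((2 * p + 1) * (2 * 2 ^ (n + n * G)) < N)%N.
  rewrite -mulnS (mulnC n) expnM -/B /N mulnA ltn_pmul2r //.
  by rewrite /c mulnC [ltnRHS]addn1.
have ltQ : (3 * N ^ G.+1 < Q)%N.
  rewrite /N /Q /q expnMn -(expnM B n) mulnC -(expnM B G.+1) [(G.+1 * n)%N]mulnC.
  rewrite mulnC mulnA ltn_pmul2r ?expn_gt0 //.
  apply: (@leq_trans (4 * c ^ G.+1)); last by rewrite leq_pmulr.
  by rewrite ltn_pmul2r // expn_gt0 c0.
have pQ : (p <= Q)%N.
  apply: (@leq_trans q); last by rewrite leq_pmulr // !expn_gt0.
  by rewrite /q leq_pmull // muln_gt0 expn_gt0 c0.
have [QA|AQ] := leqP (Q ^ L) #|A|; last first.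
  apply: (@le_trans _ _ (Q ^ L)%:R); first by rewrite ler_nat ltnW.
  rewrite /Q expnMn -(expnM _ n) [(n * L)%N]mulnC expnM -/C0 natrM ler_wpM2l ?ler0n //.
  rewrite natrX lerXn2r ?nnegrE ?mulr_ge0 ?ler0n ?(le_trans ler01 P1) //.
  apply: (@le_trans _ _ C%:R); first by rewrite ler_nat leq_addl.
  by rewrite ler_peMr ?ler0n.
have [pA|Ap] := leqP (p ^ n) (#|A| ^ t).
  by case: nzs; apply: (zsP p n A N Q).
apply: leDC; apply: (@le_trans _ _ (P ^+ n)); last first.
  by rewrite lerXn2r ?nnegrE ?mulr_ge0 ?ler0n ?(le_trans ler01 P1) // ler_peMl // (le_trans ler01).
have t0 : (0 < t)%N by case: (t) tP => //; rewrite mulr0 ler10.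
rewrite -(@ler_pXn2r _ t) ?nnegrE ?exprn_ge0 ?ler0n ?(le_trans ler01 P1) //.
rewrite exprAC -natrX; apply: (@le_trans _ _ (p ^ n)%:R); first by rewrite ler_nat ltnW.
rewrite natrX lerXn2r ?nnegrE ?exprn_ge0 ?ler0n ?(le_trans ler01 P1) //.
rewrite -powR_mulrn ?(le_trans ler01 P1) // /P -powRrM -[leLHS]powRr1 ?ler0n //.
by rewrite ler_powR ?ler1n.
Qed.
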